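(* Fix two signatures $\lambda,\mu$, integers $M,N\ge1$, and complex variables $\mathbf x=(x_1,\ldots,x_M)$, $\mathbf r=(r_1,\ldots,r_M)$, $\mathbf w=(w_1,\ldots,w_N)$, $\boldsymbol\theta=(\theta_1,\ldots,\theta_N)$, $\mathbf y=(y_1,y_2,\ldots)$, $\mathbf s=(s_1,s_2,\ldots)$ such that for some $\delta>0$ $$\left|\frac{y_k-s_k^2x_i}{y_k-x_i}\,\frac{y_k-w_j}{y_k-s_k^2w_j}\right|<1-\delta<1\qquad\text{for all }1\le i\le M,\ 1\le j\le N,\ k\ge1.$$ Then $$\sum_\nu G_{\nu/\lambda}(\mathbf w;\mathbf y;\boldsymbol\theta;\mathbf s)\,F_{\nu/\mu}(\mathbf x;\mathbf y;\mathbf r;\mathbf s)=\prod_{i=1}^M\prod_{j=1}^N\frac{x_i-\theta_j^{-2}w_j}{x_i-w_j}\sum_\varkappa G_{\mu/\varkappa}(\mathbf w;\mathbf y;\boldsymbol\theta;\mathbf s)\,F_{\lambda/\varkappa}(\mathbf x;\mathbf y;\mathbf r;\mathbf s),$$ where the sums are over all signatures $\nu$ and $\varkappa$.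
   Context: Signatures. A signature with $n$ parts is an integer sequence $\lambda=(\lambda_1\ge\ldots\ge\lambda_n\ge0)$, $n\ge0$; $\mathcal S(\lambda)=\{\lambda_j+n+1-j:1\le j\le n\}\subset\mathbb Z_{\ge1}$. Vertex weights. For $i_1,j_1,i_2,j_2\in\{0,1\}$ (numbers of paths entering from the bottom, entering from the left, exiting at the top, exiting to the right) put $W(\cdot)=W(\cdot\mid x;y;r;s)$ with $W(0,0;0,0)=1$, $W(1,1;1,1)=\frac{r^{-2}x-y}{s^{-2}y-x}$, $W(1,0;1,0)=\frac{s^{-2}y-r^{-2}x}{s^{-2}y-x}$, $W(0,1;0,1)=\frac{y-x}{s^{-2}y-x}$, $W(1,0;0,1)=\frac{x(r^{-2}-1)}{s^{-2}y-x}$, $W(0,1;1,0)=\frac{y(s^{-2}-1)}{s^{-2}y-x}$, and $W=0$ otherwise. Put $\widehat W=W/W(0,1;0,1)$. Partition functions. Let $\mathbf x=(x_1,\ldots,x_k)$, $\mathbf r=(r_1,\ldots,r_k)$. A configuration on $\mathbb Z_{\ge1}\times\{1,\ldots,k\}$ consists of vertical edge states $v(i,j)\in\{0,1\}$ ($i\ge1$, $0\le j\le k$; $v(i,j-1)$ below and $v(i,j)$ above the vertex $(i,j)$) and horizontal edge states $h(i,j)\in\{0,1\}$ ($i\ge0$, $1\le j\le k$; $h(i-1,j)$ to the left and $h(i,j)$ to the right of $(i,j)$). If $\lambda,\mu$ have the same number of parts, $G_{\lambda/\mu}(\mathbf x;\mathbf y;\mathbf r;\mathbf s)$ is the sum over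 configurations with $v(i,0)=\mathbf 1_{i\in\mathcal S(\mu)}$, $v(i,k)=\mathbf 1_{i\in\mathcal S(\lambda)}$, $h(0,j)=0$, $h(i,j)=0$ for all large $i$, of $\prod_{i,j}W(v(i,j-1),h(i-1,j);v(i,j),h(i,j)\mid x_j;y_i;r_j;s_i)$; otherwise $G_{\lambda/\mu}=0$. If $\lambda$ has $n+k$ parts and $\mu$ has $n$ parts for some $n\ge0$, $F_{\lambda/\mu}(\mathbf x;\mathbf y;\mathbf r;\mathbf s)$ is the sum over configurations with $v(i,0)=\mathbf 1_{i\in\mathcal S(\lambda)}$, $v(i,k)=\mathbf 1_{i\in\mathcal S(\mu)}$, $h(0,j)=0$, $h(i,j)=1$ for all large $i$, of the same product with $\widehat W$ in place of $W$; otherwise $F_{\lambda/\mu}=0$. These sums have finitely many nonzero terms, each with all but finitely many factors equal to $1$. Parameters are assumed such that no denominator vanishes.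
   Formalization: ''No denominator vanishes'' is read uniformly in k: for some ε>0, |s_k^{-2}y_k − w_j| ≥ ε and |y_k − x_i| ≥ ε for all i, j, k; with mere nonvanishing the sum over ν can diverge. Absolute convergence of both sums is proved as part of the conclusion. *)

(* Defs.v *)
(* The complex numbers are [R[i]] for R : realType.
   Columns are numbered from 0: [y k], [s k] stand for y_(k+1), s_(k+1), and
   column [i] is the (i+1)-st column. *)
From HB Require Import structures.
From mathcomp Require Import all_boot all_order all_algebra.
From mathcomp Require Import complex.
From mathcomp Require Import all_classical all_reals all_analysis.
From mathcomp.analysis.showcase Require Import summability.

Set Implicit Arguments.
Unset Strict Implicit.
Unset Printing Implicit Defensive.

Import Order.TTheory GRing.Theory Num.Theory.
Import numFieldNormedType.Exports.

Local Open Scope classical_set_scope.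
Local Open Scope ring_scope.

Definition signature := {l : seq nat | sorted geq l}.

Definition nparts (lam : signature) : nat := size (val lam).

(* S(lam) with 1-based elements; the part index j runs from 0 here, so that
   lam_j + n + 1 - j becomes lam_(j+1) + n - j. *)
Definition positions (lam : signature) : seq nat :=
  [seq (nth 0 (val lam) j + nparts lam - j)%N | j <- iota 0 (nparts lam)].

Definition W (C : fieldType) (x y r s : C) (i1 j1 i2 j2 : bool) : C :=
  match i1, j1, i2, j2 with
  | false, false, false, false => 1
  | true,  true,  true,  true  => (r ^- 2 * x - y) / (s ^- 2 * y - x)
  | true,  false, true,  false => (s ^- 2 * y - r ^- 2 * x) / (s ^- 2 * y - x)
  | false, true,  false, true  => (y - x) / (s ^- 2 * y - x)
  | true,  false, false, true  => x * (r ^- 2 - 1) / (s ^- 2 * y - x)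
  | false, true,  true,  false => y * (s ^- 2 - 1) / (s ^- 2 * y - x)
  | _, _, _, _ => 0
  end.

Definition What (C : fieldType) (x y r s : C) (i1 j1 i2 j2 : bool) : C :=
  W x y r s i1 j1 i2 j2 / W x y r s false true false true.

(* Edge states on k rows: [c.1 i j] is the vertical edge of column i at height
   j (below row j, above row j-1, rows being numbered from 0), and [c.2 i j] is
   the edge of row j to the left of column i, hence to the right of column i-1. *)
Definition config (k : nat) : choiceType :=
  ((nat -> 'I_k.+1 -> bool) * (nat -> 'I_k -> bool))%type.

Definition vbot (k : nat) (c : config k) (i : nat) (j : 'I_k) : bool :=
  c.1 i (widen_ord (leqnSn k) j).

Definition vtop (k : nat) (c : config k) (i : nat) (j : 'I_k) : bool :=
  c.1 i (lift ord0 j).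

Definition hleft (k : nat) (c : config k) (i : nat) (j : 'I_k) : bool :=
  c.2 i j.

Definition hright (k : nat) (c : config k) (i : nat) (j : 'I_k) : bool :=
  c.2 i.+1 j.

(* Configurations with bottom boundary A, top boundary B, empty left boundary
   and horizontal edges equal to e far to the right.  The last clause only
   discards configurations having a vertex of weight 0; it is needed because
   the product over columns below is a product with finite support, which would
   be 1 on a configuration with infinitely many such columns. *)
Definition configs (k : nat) (A B : seq nat) (e : bool) : set (config k) :=
  [set c : config k |
    [/\ forall i, c.1 i ord0 = (i.+1 \in A),
        forall i, c.1 i ord_max = (i.+1 \in B),
        forall j, c.2 0%N j = false,
        \forall i \near \oo, forall j, c.2 i j = e
      & forall i j, (vbot c i j + hleft c i j)%N
                    = (vtop c i j + hright c i j)%N :> nat]].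

Section PartitionFunctions.
Variables (C : fieldType) (k : nat).

Definition config_weight (wt : C -> C -> C -> C -> bool -> bool -> bool -> bool -> C)
    (x : 'I_k -> C) (y : nat -> C) (r : 'I_k -> C) (s : nat -> C)
    (c : config k) : C :=
  \big[*%R/1]_(i \in [set: nat]) \prod_(j < k)
    wt (x j) (y i) (r j) (s i)
       (vbot c i j) (hleft c i j) (vtop c i j) (hright c i j).

(* [G lam mu x y r s] is G_(lam/mu)(x; y; r; s), and similarly for F. *)
Definition G (lam mu : signature)
    (x : 'I_k -> C) (y : nat -> C) (r : 'I_k -> C) (s : nat -> C) : C :=
  if nparts lam == nparts mu then
    \sum_(c \in @configs k (positions mu) (positions lam) false)
      config_weight (@W C) x y r s c
  else 0.

Definition F (lam mu : signature)
    (x : 'I_k -> C) (y : nat -> C) (r : 'I_k -> C) (s : nat -> C) : C :=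
  if nparts lam == (nparts mu + k)%N then
    \sum_(c \in @configs k (positions lam) (positions mu) true)
      config_weight (@What C) x y r s c
  else 0.

End PartitionFunctions.

(* The sum over nu is infinite, so the denominators s_k^(-2) y_k - w_j of the
   weights of G and y_k - x_i of the weights of F, which range over infinitely
   many columns k, are required to stay away from 0.  Nonvanishing for each k is
   not enough for convergence: with M = 1, N = 2, lam = (0), mu empty,
   w_1 = w_2 = 1 and s_k^2 = 1 - e_k, y_k = 1 + e_k, e_k = 2^(-k^2) / 8, the
   terms of the sum over nu are unbounded for generic x_1, r_1, theta_1, theta_2
   although |(y_k - s_k^2 x_1) / (y_k - x_1) * (y_k - w_j) / (y_k - s_k^2 w_j)|
   tends to 1/2. *)
Definition nonvanishing_denominators (R : realType) (M N : nat)
    (x r : 'I_M -> R[i]) (w theta : 'I_N -> R[i]) (y s : nat -> R[i]) : Prop :=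
  [/\ [/\ forall i, r i != 0, forall j, theta j != 0 & forall k, s k != 0],
      forall i j, x i != w j,
      forall i k, s k ^- 2 * y k - x i != 0
    & exists2 eps : R, 0 < eps &
        (forall j k, (eps%:C)%C <= `|s k ^- 2 * y k - w j|) /\
        (forall i k, (eps%:C)%C <= `|y k - x i|)].

(* Main.v *)
(* Reading both sides column by column, the terms with signatures in the first L
   columns add up to partition functions of M + N stacked rows, the N rows of G
   below the M rows of F on the left and the opposite on the right, whose paths
   leave on the right through exactly the rows of F. The Yang-Baxter equation
   exchanges an adjacent row of F with one of G up to the factor
   (x - theta^(-2) w) / (x - w) and an error term in which a path leaves
   through the row of G instead of that of F. Each straight column of such a
   state has weight at most 1 - delta in absolute value, because paths in rows of
   G and holes in rows of F are equally many and can be paired. Every other column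
   moves paths upwards, which happens a bounded number of times, with weights that
   are uniformly bounded once the factors of paired paths and holes and a gauge on
   the vertical edges have been removed. So the error terms decay geometrically in
   L, and the same bound for absolute values gives unconditional summability. *)
Require Import Defs.
From HB Require Import structures.
From mathcomp Require Import all_boot all_order all_algebra.
From mathcomp Require Import complex.
From mathcomp Require Import all_classical all_reals all_analysis.
From mathcomp.analysis.showcase Require Import summability.
From mathcomp Require Import finmap zify ring lra.

Set Implicit Arguments.
Unset Strict Implicit.
Unset Printing Implicit Defensive.

Import Order.TTheory GRing.Theory Num.Theory.
Import numFieldNormedType.Exports.

Local Open Scope classical_set_scope.
Local Open Scope ring_scope.

(** * Transfer matrices *)

Fixpoint words (n : nat) : seq (seq bool) :=
  if n is n'.+1 then [seq b :: h | b <- [:: false; true], h <- words n']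
  else [:: [::]].

Lemma mem_words n h : (h \in words n) = (size h == n).
Proof.
elim: n h => [|n IH] h; first by rewrite inE -size_eq0.
apply/allpairsP/eqP => [[[b w] /= [_]]|].
  by rewrite IH => /eqP <- ->.
case: h => // b w [] sw; exists (b, w); split => //=; last by rewrite IH sw.
by case: (b).
Qed.

Lemma words_uniq n : uniq (words n).
Proof.
elim: n => // n IH; apply: allpairs_uniq => //.
by move=> [b w] [b' w'] _ _ /= [-> ->].
Qed.

Section BigWords.
Variables (V : nmodType).

Lemma big_words0 (F : seq bool -> V) : \sum_(h <- words 0) F h = F [::].
Proof. exact: big_seq1. Qed.

Lemma big_wordsS n (F : seq bool -> V) :
  \sum_(h <- words n.+1) F h = \sum_(b : bool) \sum_(h <- words n) F (b :: h).
Proof. by rewrite /= cats0 big_cat !big_map [RHS]big_bool [RHS]addrC. Qed.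

Arguments words : simpl never.

Lemma big_words_cat m n (F : seq bool -> V) :
  \sum_(h <- words (m + n)) F h
  = \sum_(h1 <- words m) \sum_(h2 <- words n) F (h1 ++ h2).
Proof.
elim: m F => [|m IH] F; first by rewrite big_words0.
by rewrite addSn !big_wordsS; apply: eq_bigr => b _; rewrite IH.
Qed.

Lemma big_words_rcons n (F : seq bool -> V) :
  \sum_(h <- words n.+1) F h
  = \sum_(h <- words n) \sum_(b : bool) F (rcons h b).
Proof.
rewrite -addn1 big_words_cat; apply: eq_bigr => h _.
by rewrite big_wordsS; apply: eq_bigr => b _; rewrite big_words0 cats1.
Qed.

End BigWords.
Arguments words : simpl never.

Lemma sumr_words_const (S : pzRingType) n (x : S) :
  \sum_(h <- words n) x = 2 ^+ n * x.
Proof.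
elim: n => [|n IH]; first by rewrite big_words0 mul1r.
by rewrite big_wordsS big_bool /= IH exprS -mulrA mulr_natl mulr2n.
Qed.

Section Transfer.
Variables (C : fieldType) (I : Type).
Variable wt : I -> nat -> bool -> bool -> bool -> bool -> C.

(* The weight of column [i] on the rows [st], listed from bottom to top, with [u]
   below, [t] above, and horizontal edges [l] to the left and [r] to the right. *)
Fixpoint colw (st : seq I) (i : nat) (u t : bool) (l r : seq bool) : C :=
  match st, l, r with
  | k :: st', a :: l', b :: r' =>
      \sum_(v : bool) wt k i u a v b * colw st' i v t l' r'
  | _, _, _ => (u == t)%:R
  end.

(* The partition function of the first [L] columns, with empty left boundary,
   bottom boundary [A], top boundary [B] and right boundary [h]. *)
Fixpoint Z (st : seq I) (A B : nat -> bool) (L : nat) (h : seq bool) : C :=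
  if L is L'.+1 then
    \sum_(g <- words (size st)) Z st A B L' g * colw st L' (A L') (B L') g h
  else (h == nseq (size st) false)%:R.

Lemma eq_Z st A A' B B' L h :
  (forall i, (i < L)%N -> A i = A' i) -> (forall i, (i < L)%N -> B i = B' i) ->
  Z st A B L h = Z st A' B' L h.
Proof.
elim: L h => // L IH h eA eB /=; apply: eq_bigr => g _.
by rewrite IH ?eA ?eB // => i iL; rewrite ?eA ?eB // ltnW.
Qed.

Lemma colw_cat st1 st2 i u t l1 l2 r1 r2 :
  size l1 = size st1 -> size r1 = size st1 ->
  colw (st1 ++ st2) i u t (l1 ++ l2) (r1 ++ r2)
  = \sum_(v : bool) colw st1 i u v l1 r1 * colw st2 i v t l2 r2.
Proof.
elim: st1 l1 r1 u => [|k st1 IH] [|a l1] [|b r1] //= u.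
  by move=> _ _; rewrite big_bool /=; case: u; rewrite !(mul0r, mul1r, addr0, add0r).
move=> [sl] [sr]; under eq_bigr do rewrite IH // big_distrr /=.
rewrite exchange_big; apply: eq_bigr => v _ /=.
by rewrite big_distrl; apply: eq_bigr => v' _ /=; rewrite mulrA.
Qed.

(** The word [V] records the vertical edges between the two stacks. In the induction on [L], the cut
    edge of the last column becomes the last letter of [V]. *)
Lemma Z_cat st1 st2 A B L h1 h2 : size h1 = size st1 -> size h2 = size st2 ->
  Z (st1 ++ st2) A B L (h1 ++ h2)
  = \sum_(V <- words L) Z st1 A (nth false V) L h1 * Z st2 (nth false V) B L h2.
Proof.
elim: L h1 h2 => [|L IH] h1 h2 s1 s2.
  rewrite big_words0 /= size_cat nseqD eqseq_cat ?size_nseq //.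
  by rewrite -natrM mulnb.
rewrite big_words_rcons /= size_cat big_words_cat.
transitivity (\sum_(V <- words L) \sum_(b : bool)
    \sum_(g1 <- words (size st1)) \sum_(g2 <- words (size st2))
      (Z st1 A (nth false V) L g1 * Z st2 (nth false V) B L g2)
      * (colw st1 L (A L) b g1 h1 * colw st2 L b (B L) g2 h2)); last first.
  apply: eq_big_seq => V; rewrite mem_words => /eqP sV; apply: eq_bigr => b _.
  have nthV i : (i < L)%N -> nth false (rcons V b) i = nth false V i.
    by move=> iL; rewrite nth_rcons sV iL.
  have nthL : nth false (rcons V b) L = b by rewrite nth_rcons sV ltnn eqxx.
  rewrite big_distrl; apply: eq_bigr => g1 _ /=.
  rewrite big_distrr; apply: eq_bigr => g2 _ /=.
  rewrite nthL mulrACA; by congr (_ * _ * (_ * _)); apply: eq_Z => // i iL; rewrite nthV.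
under [RHS]eq_bigr => V _.
  rewrite exchange_big /=; under eq_bigr do rewrite exchange_big /=.
  over.
rewrite [RHS]exchange_big /=; apply: eq_big_seq => g1; rewrite mem_words => /eqP sg1.
rewrite [RHS]exchange_big /=; apply: eq_big_seq => g2; rewrite mem_words => /eqP sg2.
rewrite IH // colw_cat // big_distrl /=; apply: eq_bigr => V _.
by rewrite big_distrr.
Qed.

Lemma colw_cons k st i u t a l b r :
  colw (k :: st) i u t (a :: l) (b :: r)
  = \sum_(v : bool) wt k i u a v b * colw st i v t l r.
Proof. by []. Qed.

Arguments colw : simpl never.

(** * Moving a crossing through the columns *)

Variables (g f : I) (R : bool -> bool -> bool -> bool -> C) (al : C).

Hypothesis ybe : forall i u t lg lf rf rg,
  \sum_(a : bool) \sum_(b : bool)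
     colw [:: g; f] i u t [:: lg; lf] [:: a; b] * R a b rf rg
  = \sum_(a : bool) \sum_(b : bool)
     R lg lf b a * colw [:: f; g] i u t [:: b; a] [:: rf; rg].
Hypothesis R0 : forall b a, R false false b a = (~~ b && ~~ a)%:R * al.

(** The crossing [R] has [g] below [f] on its left and [f] below [g] on its right. [ybe] moves it
    leftwards through one column per induction step, the rows of [pre] and [post] being spectators.
    At the left boundary all edges are empty, and [R0] turns it into the scalar [al]. *)
Lemma Z_swap pre post A B L hp hq rf rg :
  size hp = size pre -> size hq = size post ->
  \sum_(a : bool) \sum_(b : bool)
    Z (pre ++ g :: f :: post) A B L (hp ++ a :: b :: hq) * R a b rf rg
  = al * Z (pre ++ f :: g :: post) A B L (hp ++ rf :: rg :: hq).
Proof.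
have catE (st : seq I) x z : st ++ x :: z :: post = st ++ [:: x; z] ++ post by [].
have catE' (h : seq bool) x z h' : h ++ x :: z :: h' = h ++ [:: x; z] ++ h' by [].
elim: L hp hq rf rg => [|L IH] hp hq rf rg sp sq.
  rewrite /= !size_cat /= !nseqD /=.
  rewrite !big_bool /= !eqseq_cat ?size_nseq //= R0 !eqseq_cons /=.
  case: rf; case: rg => /=; rewrite ?andbF ?andbT /=; ring.
have sumE (F : seq bool -> C) :
    \sum_(h <- words (size pre + (size post).+2)) F h
    = \sum_(gp <- words (size pre)) \sum_(gq <- words (size post))
       \sum_(a : bool) \sum_(b : bool) F (gp ++ a :: b :: gq).
  rewrite big_words_cat; apply: eq_bigr => gp _.
  rewrite big_wordsS; under eq_bigr do rewrite big_wordsS.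
  rewrite [RHS]exchange_big /=; apply: eq_bigr => a _.
  by rewrite [RHS]exchange_big.
have colE x z gp gq a b a' b' : size gp = size pre -> size gq = size post ->
    colw (pre ++ x :: z :: post) L (A L) (B L)
         (gp ++ a :: b :: gq) (hp ++ a' :: b' :: hq)
    = \sum_(v : bool) \sum_(v' : bool)
        colw pre L (A L) v gp hp * colw post L v' (B L) gq hq
        * colw [:: x; z] L v v' [:: a; b] [:: a'; b'].
  move=> sgp sgq; rewrite catE (catE' gp) (catE' hp) colw_cat //.
  apply: eq_bigr => v _; rewrite colw_cat // big_distrr /=.
  by apply: eq_bigr => v' _; rewrite mulrA mulrAC.
have ZS x z b a : Z (pre ++ x :: z :: post) A B L.+1 (hp ++ b :: a :: hq)
  = \sum_(gp <- words (size pre)) \sum_(gq <- words (size post))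
      \sum_(v : bool) \sum_(v' : bool)
      colw pre L (A L) v gp hp * colw post L v' (B L) gq hq *
      \sum_(a' : bool) \sum_(b' : bool)
        Z (pre ++ x :: z :: post) A B L (gp ++ a' :: b' :: gq)
        * colw [:: x; z] L v v' [:: a'; b'] [:: b; a].
  rewrite [LHS]/= size_cat [X in words (_ + X)]/= sumE.
  apply: eq_big_seq => gp; rewrite mem_words => /eqP sgp.
  apply: eq_big_seq => gq; rewrite mem_words => /eqP sgq.
  under [LHS]eq_bigr do under eq_bigr do rewrite colE //.
  rewrite !big_bool /=; ring.
under eq_bigr do under eq_bigr do rewrite ZS.
rewrite ZS [RHS]big_distrr /=.
transitivity (\sum_(gp <- words (size pre)) \sum_(gq <- words (size post))
    \sum_(a : bool) \sum_(b : bool)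
    (\sum_(v : bool) \sum_(v' : bool)
      colw pre L (A L) v gp hp * colw post L v' (B L) gq hq *
      \sum_(a' : bool) \sum_(b' : bool)
        Z (pre ++ g :: f :: post) A B L (gp ++ a' :: b' :: gq)
        * colw [:: g; f] L v v' [:: a'; b'] [:: a; b]) * R a b rf rg).
  under eq_bigr do under eq_bigr do rewrite big_distrl /=.
  under eq_bigr do rewrite exchange_big /=.
  rewrite exchange_big; apply: eq_bigr => gp _ /=.
  under eq_bigr do under eq_bigr do rewrite big_distrl /=.
  under eq_bigr do rewrite exchange_big /=.
  by rewrite exchange_big.
apply: eq_big_seq => gp; rewrite mem_words => /eqP sgp.
rewrite big_distrr /=; apply: eq_big_seq => gq; rewrite mem_words => /eqP sgq.
transitivity (\sum_(v : bool) \sum_(v' : bool)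
   colw pre L (A L) v gp hp * colw post L v' (B L) gq hq *
   \sum_(a' : bool) \sum_(b' : bool)
     Z (pre ++ g :: f :: post) A B L (gp ++ a' :: b' :: gq) *
     \sum_(a : bool) \sum_(b : bool)
        colw [:: g; f] L v v' [:: a'; b'] [:: a; b] * R a b rf rg).
  rewrite !big_bool /=; ring.
rewrite big_distrr; apply: eq_bigr => v _; rewrite big_distrr; apply: eq_bigr => v' _.
rewrite /= mulrCA; congr (_ * _).
under eq_bigr do under eq_bigr do rewrite ybe.
rewrite big_distrr; under [RHS]eq_bigr do rewrite big_distrr.
under [RHS]eq_bigr do under eq_bigr do rewrite /= mulrA -IH //.
rewrite !big_bool /=; ring.
Qed.
End Transfer.
Arguments colw : simpl never.


(** * The Yang-Baxter equation *)

(* Scaled so that the empty crossing has weight [x - th ^- 2 * w], not 1: this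
   may vanish. *)
Definition crossing (C : fieldType) (x r w th : C) (a b b' a' : bool) : C :=
  match a, b, b', a' with
  | false, false, false, false => x - th ^- 2 * w
  | true,  true,  true,  true  => w - r ^- 2 * x
  | true,  false, true,  false => (1 - r ^- 2) * x
  | true,  false, false, true  => r ^- 2 * x - th ^- 2 * w
  | false, true,  true,  false => x - w
  | false, true,  false, true  => (1 - th ^- 2) * w
  | _, _, _, _ => 0
  end.

(** The parameters [s], [r], [th] enter through inverse squares, which are replaced by free
    variables. Each of the 64 boundary states then gives an identity of rational functions. *)
Lemma yang_baxter (C : fieldType) (I : Type)
    (wt : I -> nat -> bool -> bool -> bool -> bool -> C) (g f : I) i
    (x y r s w th : C) u t a b b' a' :
  wt g i = W w y th s -> wt f i = What x y r s ->
  s ^- 2 * y - w != 0 -> s ^- 2 * y - x != 0 -> y - x != 0 ->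
  \sum_(c : bool) \sum_(d : bool)
     colw wt [:: g; f] i u t [:: a; b] [:: c; d] * crossing x r w th c d b' a'
  = \sum_(c : bool) \sum_(d : bool)
     crossing x r w th a b d c * colw wt [:: f; g] i u t [:: d; c] [:: b'; a'].
Proof.
move=> wg wf; rewrite /colw !big_bool /= wg wf /What /W /crossing.
move: (s ^- 2) (r ^- 2) (th ^- 2) => S P Q dw dx dy.
case: u; case: t; case: a; case: b; case: b'; case: a';
  rewrite /= ?(mulr0, mul0r, addr0, add0r, mulr1, mul1r) //;
  by field; rewrite ?dw ?dx ?dy.
Qed.

(** * Conservation laws and exponential decay *)

Lemma big_bool_neq0 (V : nmodType) (F : bool -> V) :
  \sum_(v : bool) F v != 0 -> exists v, F v != 0.
Proof.
rewrite big_bool; case: (eqVneq (F true) 0) => [/= ->|]; last by exists true.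
by rewrite /= add0r; exists false.
Qed.

Lemma big_seq_neq0 (V : nmodType) (T : eqType) (s : seq T) (F : T -> V) :
  \sum_(h <- s) F h != 0 -> exists2 h, h \in s & F h != 0.
Proof.
move=> Fs; apply: contrapT => noh; move: Fs; rewrite big_seq big1 ?eqxx // => h hs.
by apply: contrapT => /eqP Fh; apply: noh; exists h.
Qed.

(* The sum of the positions of the 1s, counted from the bottom. Paths only move
   up, so in columns without boundary paths this rank can only increase. *)
Fixpoint rk (h : seq bool) : nat :=
  if h is _ :: h' then (rk h' + count id h')%N else 0%N.

Section Conservation.
Variables (C : fieldType) (I : Type).
Variable wt : I -> nat -> bool -> bool -> bool -> bool -> C.
Hypothesis wt_conserve :
  forall k i u a v b, wt k i u a v b != 0 -> (u + a = v + b :> nat)%N.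

Lemma colw_conserve st i u t l r : size l = size st -> size r = size st ->
  colw wt st i u t l r != 0 -> (u + count id l = t + count id r :> nat)%N.
Proof.
elim: st l r u => [|k st IH] [|a l] [|b r] //= u.
  by move=> _ _; rewrite /colw /=; case: (u =P t) => [->|]; rewrite ?eqxx.
move=> [sl] [sr]; rewrite colw_cons => /big_bool_neq0[v].
rewrite mulf_eq0 negb_or => /andP[/wt_conserve uv /(IH _ _ _ sl sr) e].
lia.
Qed.

(** The rank of [a :: l] is [rk l + count id l]. As the top edge is empty, conservation above the
    lowest row gives [v + count id l = count id r], so the rank cannot decrease, and equal ranks
    force [v] to be empty. A path entering at [u] is allowed so that the induction applies to the
    remaining rows. *)
Lemma colw_rank st i u l r : size l = size st -> size r = size st ->
  colw wt st i u false l r != 0 ->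
  (rk l <= rk r)%N /\ (u = false -> rk l = rk r -> l = r).
Proof.
elim: st l r u => [|k st IH] [|a l] [|b r] //= u [sl] [sr].
rewrite colw_cons => /big_bool_neq0[v].
rewrite mulf_eq0 negb_or => /andP[/wt_conserve uv nz].
have e := colw_conserve sl sr nz; have [le eq] := IH _ _ _ sl sr nz.
split=> [|u0 rke]; first lia.
have v0 : v = false by apply/negbTE/negP => vt; move: e rke le; rewrite vt /=; lia.
subst u v; rewrite (eq _ _) //; last by lia.
by move: uv; case: (a); case: (b).
Qed.

Lemma Z_conserve st A B L h : size h = size st -> Z wt st A B L h != 0 ->
  (\sum_(i < L) A i = \sum_(i < L) B i + count id h :> nat)%N.
Proof.
elim: L h => [|L IH] h sh /=.
  case: (h =P _) => [->|]; rewrite ?eqxx // !big_ord0 => _.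
  by elim: (size st) => //.
move=> /big_seq_neq0[g]; rewrite mem_words => /eqP sg.
rewrite mulf_eq0 negb_or => /andP[/(IH _ sg) e /(colw_conserve sg sh) e'].
by rewrite !big_ord_recr /= e -!addnA (addnC (count id g)) e'.
Qed.

End Conservation.

Section Decay.
Variables (C : numFieldType) (I : Type) (isF : I -> bool).
Variable wt : I -> nat -> bool -> bool -> bool -> bool -> C.
Hypothesis wt_conserve :
  forall k i u a v b, wt k i u a v b != 0 -> (u + a = v + b :> nat)%N.
Hypothesis wt_ge0 : forall k i u a v b, 0 <= wt k i u a v b.
Hypothesis wt_fl : forall k i, wt k i false (isF k) false (isF k) = 1.

Lemma colw_ge0 st i u t l r : 0 <= colw wt st i u t l r.
Proof.
elim: st l r u => [|k st IH] [|a l] [|b r] u; rewrite /colw //= ?ler0n //.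
by apply: sumr_ge0 => v _; rewrite mulr_ge0.
Qed.

Lemma Z_ge0 st A B L h : 0 <= Z wt st A B L h.
Proof.
elim: L h => [|L IH] h /=; first exact: ler0n.
by apply: sumr_ge0 => g _; rewrite mulr_ge0 ?colw_ge0.
Qed.

Lemma colw_straight st i h : size h = size st ->
  colw wt st i false false h h = \prod_(p <- zip st h) wt p.1 i false p.2 false p.2.
Proof.
elim: st h => [|k st IH] [|b h] //=; first by rewrite /colw /= big_nil.
move=> [sh]; rewrite colw_cons big_bool /= big_cons IH //=.
suff -> : wt k i false b true b = 0 by rewrite mul0r add0r.
by apply: contrapT => /eqP /wt_conserve; case: (b).
Qed.

Lemma colw_fl st i :
  colw wt st i false false (map isF st) (map isF st) = 1.
Proof.
rewrite colw_straight ?size_map //; elim: st => [|k st IH] /=; first by rewrite big_nil.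
by rewrite big_cons IH /= wt_fl mulr1.
Qed.

(** Beyond the boundary paths, prolonging the final state by one column has weight 1, and all other
    terms are nonnegative. *)
Lemma Z_fl_mono st A B L L' : (L <= L')%N ->
  (forall i, (L <= i)%N -> A i = false) -> (forall i, (L <= i)%N -> B i = false) ->
  Z wt st A B L (map isF st) <= Z wt st A B L' (map isF st).
Proof.
move=> /subnKC <- A0 B0; elim: (L' - L)%N => [|d IH]; first by rewrite addn0.
rewrite (le_trans IH) // addnS /= A0 ?B0 ?leq_addr //.
rewrite (bigD1_seq (map isF st)) ?mem_words ?size_map ?words_uniq //= colw_fl mulr1.
by rewrite lerDl sumr_ge0 // => g _; rewrite mulr_ge0 ?Z_ge0 ?colw_ge0.
Qed.

(* One factor [a] per path in a row of G and one factor [b] per hole in a row of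
   F; conservation makes these equally many (see [facE]). *)
Definition rowfac (a b : C) (k : I) (e : bool) : C :=
  if isF k then (if e then 1 else b) else (if e then a else 1).

Definition fac a b (st : seq I) (h : seq bool) : C :=
  \prod_(p <- zip st h) rowfac a b p.1 p.2.

Lemma facE st h : size h = size st ->
  count id h = count id (map isF st) ->
  exists2 m, forall a b, fac a b st h = (a * b) ^+ m & m = 0%N -> h = map isF st.
Proof.
move=> sh ch.
(* [m] counts the paths in rows of G and [m'] the holes in rows of F. *)
suff [m [m' [facm mm' m0]]] : exists m m' : nat, [/\
    forall a b, fac a b st h = a ^+ m * b ^+ m',
    (m + count id (map isF st) = m' + count id h)%N
    & m = 0%N -> m' = 0%N -> h = map isF st].
  have mE : m = m' by lia.
  by subst m'; exists m => [a b|/[dup]/m0]; [rewrite facm exprMn|].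
elim: st h sh {ch} => [|k st IH] [|e h] //= => [_|[sh]].
  by exists 0%N, 0%N; split => // a b; rewrite /fac big_nil mul1r.
have [m [m' [facm mm' m0]]] := IH _ sh.
exists (m + (e && ~~ isF k))%N, (m' + (~~ e && isF k))%N; split.
- move=> a b; rewrite /fac /= big_cons -/(fac a b st h) facm /= /rowfac.
  by case: (isF k); case: (e); rewrite /= ?addn0 ?addn1 ?exprS; ring.
- by case: (isF k); case: (e); rewrite /=; lia.
- case: (isF k); case: (e) => /=; rewrite ?addn0 ?addn1 // => ? ?; congr (_ :: _); exact: m0.
Qed.

Variables (K rho : C) (ga gb q al be : nat -> C).
Hypothesis K_gt0 : 0 < K.
Hypothesis rho_lt1 : 0 < rho < 1.
Hypothesis gab : forall i, ga i * gb i = 1.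
Hypothesis q_gt0 : forall i, 0 < q i.
Hypothesis al_ge0 : forall i, 0 <= al i.
Hypothesis be_ge0 : forall i, 0 <= be i.
Hypothesis albe : forall i, al i * be i <= rho.
(* The factors [q] of the vertical edges telescope along a column. *)
Hypothesis wt_gauge : forall k i (u a v b : bool),
  wt k i u a v b <= K * rowfac (ga i) (gb i) k b * (q i ^+ v / q i ^+ u).
Hypothesis wt_straight : forall k i b,
  wt k i false b false b <= rowfac (al i) (be i) k b.

(** The 2 beside [K] counts the states of the vertical edge above each row. *)
Lemma colw_gauge st i u t l r : size l = size st -> size r = size st ->
  colw wt st i u t l r
    <= (2 * K) ^+ size st * fac (ga i) (gb i) st r * (q i ^+ t / q i ^+ u).
Proof.
elim: st l r u => [|k st IH] [|a l] [|b r] //= u.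
  rewrite /colw /fac /= big_nil expr0 !mul1r => _ _.
  case: (u =P t) => [->|_]; last by rewrite divr_ge0 // exprn_ge0 // ltW.
  by rewrite divff // expf_neq0 // gt_eqF.
move=> [sl] [sr]; rewrite colw_cons /fac /= big_cons -/(fac _ _ st r) /=.
rewrite exprS.
set X := (2 * K) ^+ _; set Y := fac _ _ _ _.
have E v : K * rowfac (ga i) (gb i) k b * (q i ^+ v / q i ^+ u)
      * (X * Y * (q i ^+ t / q i ^+ v))
      = (K * rowfac (ga i) (gb i) k b * X * Y) * (q i ^+ t / q i ^+ u).
  have q0 w : q i ^+ w != 0 by rewrite expf_neq0 // gt_eqF.
  by field; rewrite !q0.
apply: (@le_trans _ _ (\sum_(v : bool)
   (K * rowfac (ga i) (gb i) k b * X * Y) * (q i ^+ t / q i ^+ u))).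
  apply: ler_sum => v _; rewrite -(E v).
  by apply: ler_pM; rewrite ?colw_ge0 ?wt_gauge ?IH.
by rewrite le_eqVlt; apply/orP; left; apply/eqP; rewrite big_bool /=; ring.
Qed.

Let sector st h := size h = size st /\ count id h = count id (map isF st).

(** In the sector, [fac] is a power of [ga i * gb i = 1], and the vertical gauge is trivial since
    both ends of the column are empty. *)
Lemma colw_bounded st i l r : sector st r -> size l = size st ->
  colw wt st i false false l r <= (2 * K) ^+ size st.
Proof.
move=> [sr cr] sl; apply: (le_trans (colw_gauge _ _ _ sl sr)).
have [m -> _] := facE sr cr.
by rewrite gab expr1n mulr1 !expr0 divr1 mulr1.
Qed.

(** A state of the sector other than the final one has at least one pair of a path in a row of G and
    a hole in a row of F. One pair contributes [al i * be i], the others at most 1. *)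
Lemma colw_diag_le st i h : sector st h -> h <> map isF st ->
  colw wt st i false false h h <= rho.
Proof.
move=> [sh ch] hfl; rewrite colw_straight //.
apply: (@le_trans _ _ (fac (al i) (be i) st h)).
  apply: ler_prod => -[k b] _ /=; by rewrite wt_ge0 wt_straight.
have [[|m] -> m0] := facE sh ch; first by case: hfl; apply: m0.
have/andP[r0 r1] := rho_lt1.
have ab0 : 0 <= al i * be i by rewrite mulr_ge0.
have ab1 : al i * be i <= 1 by rewrite (le_trans (albe i)) // ltW.
rewrite exprS (le_trans _ (albe i)) // ler_piMr //.
by rewrite exprn_ile1.
Qed.

Variables (st : seq I) (A B : nat -> bool) (L0 : nat).
Hypothesis A0 : forall i, (L0 <= i)%N -> A i = false.
Hypothesis B0 : forall i, (L0 <= i)%N -> B i = false.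
Hypothesis AB : (\sum_(i < L0) A i = \sum_(i < L0) B i + count isF st :> nat)%N.

Lemma Z_sector L h : (L0 <= L)%N -> size h = size st ->
  Z wt st A B L h != 0 -> sector st h.
Proof.
move=> L0L sh /(Z_conserve wt_conserve sh) e; split=> //.
suff E (D : nat -> bool) : (forall i, (L0 <= i)%N -> D i = false) ->
    (\sum_(i < L) D i = \sum_(i < L0) D i :> nat)%N.
  by move: e; rewrite !E // AB count_map (eq_count (a2 := isF)) // => /addnI.
move=> D0; rewrite -!(big_mkord xpredT (fun i => D i : nat)).
rewrite (big_cat_nat (n := L0)) //= [X in (_ + X)%N]big_nat_cond [X in (_ + X)%N]big1 ?addn0 //.
by move=> i /andP[/andP[/D0 ->]].
Qed.

(** The midpoint of [rho] and 1 leaves a margin [(1 - rho) / 2] for the transitions that raise the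
    rank. *)
Definition rate := (1 + rho) / 2.
(** Chosen so that [2 ^+ size st] preceding states, each with a transition of weight at most
    [(2 * K) ^+ size st], together stay within this margin after division by [base]. *)
Let base := (2 ^+ size st * (2 * K) ^+ size st) / ((1 - rho) / 2) + 1.

Lemma rate_bounds : 0 < rate < 1.
Proof.
have/andP[r0 r1] := rho_lt1; rewrite /rate divr_gt0 ?addr_gt0 //=.
by rewrite ltr_pdivrMr // mul1r [ltRHS](_ : _ = 1 + 1) ?ltrD2l.
Qed.

Let base_ge1 : 1 <= base.
Proof.
have/andP[r0 r1] := rho_lt1.
rewrite /base lerDr; apply: divr_ge0; last by rewrite ltW // divr_gt0 // subr_gt0.
by rewrite mulr_ge0 ?exprn_ge0 ?mulr_ge0 // ltW.
Qed.

Let base_rate : rho + 2 ^+ size st * ((2 * K) ^+ size st / base) <= rate.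
Proof.
have/andP[r0 r1] := rho_lt1.
have b0 : 0 < base by rewrite (lt_le_trans ltr01).
have e : 0 < (1 - rho) / 2 by rewrite divr_gt0 // subr_gt0.
have -> : rate = rho + (1 - rho) / 2 by rewrite /rate; field.
rewrite lerD2l mulrA ler_pdivrMr // [leRHS]mulrC -ler_pdivrMr //.
by rewrite /base lerDl.
Qed.

(* States of rank below that of the final one differ from it, so each straight
   column costs a factor [rho]; all other transitions raise the rank, and the
   powers of [base] absorb them. *)
Lemma Z_decay : exists2 c : C, 0 <= c & forall L h, (L0 <= L)%N ->
  size h = size st -> (rk h < rk (map isF st))%N ->
  Z wt st A B L h <= c * base ^+ rk h * rate ^+ L.
Proof.
have/andP[r0 r1] := rate_bounds; have b0 : 0 < base by rewrite (lt_le_trans ltr01).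
(* The sum over all states bounds each of them, and the division by [rate ^+ L0] makes the estimate
   hold at [L = L0]. *)
pose c := (\sum_(h <- words (size st)) Z wt st A B L0 h) / rate ^+ L0.
have c0 : 0 <= c.
  apply: divr_ge0; last by rewrite exprn_ge0 // ltW.
  by rewrite sumr_ge0 // => h _; apply: Z_ge0.
exists c => // L h L0L; rewrite -(subnKC L0L); move: (L - L0)%N => d {L L0L}.
have pow_ge0 p : 0 <= base ^+ p by rewrite exprn_ge0 // ltW.
have rate_ge0 p : 0 <= rate ^+ p by rewrite exprn_ge0 // ltW.
elim: d h => [|d IH] h sh rh.
  rewrite addn0 mulrAC /c divfK ?expf_neq0 ?gt_eqF //.
  have S0 : 0 <= \sum_(h <- words (size st)) Z wt st A B L0 h.
    by rewrite sumr_ge0 // => g _; apply: Z_ge0.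
  rewrite (@le_trans _ _ (\sum_(h <- words (size st)) Z wt st A B L0 h)) //; last first.
    by rewrite ler_peMr // exprn_ege1.
  rewrite (big_rem h) ?mem_words ?sh //= lerDl.
  by rewrite sumr_ge0 // => g _; apply: Z_ge0.
set L := (L0 + d)%N in IH *; have L0L : (L0 <= L)%N by rewrite leq_addr.
rewrite addnS -/L /= A0 // B0 //.
pose M := (2 * K) ^+ size st.
have M0 : 0 <= M by rewrite exprn_ge0 // mulr_ge0 // ltW.
(* The predecessor [g = h] costs [rho]. Any other predecessor that contributes has smaller rank,
   which leaves one power of [base] to divide by. *)
have term g : g \in words (size st) ->
    Z wt st A B L g * colw wt st L false false g h
    <= c * base ^+ rk h * rate ^+ L * ((g == h)%:R * rho + M / base).
  rewrite mem_words => /eqP sg.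
  have rhs0 : 0 <= c * base ^+ rk h * rate ^+ L * ((g == h)%:R * rho + M / base).
    have/andP[/ltW rho0 _] := rho_lt1.
    apply: mulr_ge0; first by rewrite mulr_ge0 // mulr_ge0.
    apply: addr_ge0; first by rewrite mulr_ge0 ?ler0n.
    by rewrite divr_ge0 // ltW.
  have [->|Zg0] := eqVneq (Z wt st A B L g) 0; first by rewrite mul0r.
  have [->|Cg0] := eqVneq (colw wt st L false false g h) 0; first by rewrite mulr0.
  have [_ cg] := Z_sector L0L sg Zg0.
  have ch : count id h = count id (map isF st).
    by have := colw_conserve wt_conserve sg sh Cg0; rewrite cg.
  have [rgh gh] := colw_rank wt_conserve sg sh Cg0.
  have [e|ne] := eqVneq g h.
    subst g; rewrite mul1r mulrDr -[leLHS]addr0 lerD //; last first.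
      apply: mulr_ge0; first by rewrite mulr_ge0 // mulr_ge0.
      by rewrite divr_ge0 // ltW.
    apply: ler_pM; rewrite ?Z_ge0 ?colw_ge0 // ?IH //.
    by apply: colw_diag_le => // hfl; move: rh; rewrite hfl ltnn.
  have rlt : (rk g < rk h)%N.
    rewrite ltn_neqAle rgh andbT; apply/eqP => e.
    by move/eqP: ne; apply; apply: gh.
  rewrite mul0r add0r.
  apply: (@le_trans _ _ (c * base ^+ rk g * rate ^+ L * M)).
    apply: ler_pM; rewrite ?Z_ge0 ?colw_ge0 //.
      by apply: IH => //; apply: ltn_trans rh.
    exact: colw_bounded.
  have -> : c * base ^+ rk h * rate ^+ L * (M / base)
      = c * base ^+ (rk h).-1 * rate ^+ L * M.
    have b1 : base != 0 by rewrite gt_eqF.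
    by case: (rk h) rlt => // p _; rewrite exprS /=; field.
  rewrite ler_wpM2r // ler_wpM2r // ler_wpM2l //.
  by apply: ler_weXn2l => //; case: (rk h) rlt.
apply: (@le_trans _ _ (\sum_(g <- words (size st))
    c * base ^+ rk h * rate ^+ L * ((g == h)%:R * rho + M / base))).
  by rewrite big_seq [leRHS]big_seq; apply: ler_sum => g /term.
rewrite -big_distrr exprS [rate * _]mulrC mulrA /=.
apply: ler_wpM2l; first by rewrite mulr_ge0 // mulr_ge0.
apply: le_trans base_rate; rewrite big_split /= lerD //.
  rewrite (bigD1_seq h) ?mem_words ?sh ?words_uniq //= eqxx mul1r.
  by rewrite big1 ?addr0 // => g /negbTE ->; rewrite mul0r.
by rewrite sumr_words_const.
Qed.

(** The growth from one column to the next comes from states of smaller rank than the final one.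
    [Z_decay] bounds it by a geometric sequence, which is then summed. *)
Lemma Z_fl_tail : exists2 c : C, 0 <= c & forall L L', (L0 <= L <= L')%N ->
  0 <= Z wt st A B L' (map isF st) - Z wt st A B L (map isF st) <= c * rate ^+ L.
Proof.
have [c c0 dec] := Z_decay; have/andP[r0 r1] := rate_bounds.
have b0 : 0 < base by rewrite (lt_le_trans ltr01).
pose M := (2 * K) ^+ size st.
have M0 : 0 <= M by rewrite exprn_ge0 // mulr_ge0 // ltW.
pose c1 := 2 ^+ size st * (c * base ^+ rk (map isF st) * M).
have c10 : 0 <= c1.
  by rewrite mulr_ge0 ?exprn_ge0 // mulr_ge0 // mulr_ge0 // exprn_ge0 // ltW.
have t0 p e : 0 <= c * base ^+ p * rate ^+ e * M.
  apply: mulr_ge0 => //; apply: mulr_ge0; last by rewrite exprn_ge0 // ltW.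
  by rewrite mulr_ge0 // exprn_ge0 // ltW.
have step L : (L0 <= L)%N ->
    0 <= Z wt st A B L.+1 (map isF st) - Z wt st A B L (map isF st) <= c1 * rate ^+ L.
  move=> L0L; set f := map isF st.
  have sf : size f = size st by rewrite size_map.
  rewrite [Z _ _ _ _ L.+1 _]/= A0 // B0 //.
  rewrite (bigD1_seq f) ?mem_words ?sf ?words_uniq //= colw_fl mulr1 addrAC subrr add0r.
  rewrite sumr_ge0 /=; last by move=> g _; rewrite mulr_ge0 ?Z_ge0 ?colw_ge0.
  have -> : c1 * rate ^+ L
      = \sum_(g <- words (size st)) (c * base ^+ rk f * rate ^+ L * M).
    by rewrite sumr_words_const /c1 -/f -!mulrA [rate ^+ L * M]mulrC.
  rewrite big_seq_cond [leRHS]big_seq big_mkcond /= [leRHS]big_mkcond.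
  apply: ler_sum => g _; case: ifP => [/andP[gw gf]|_]; last first.
    by case: ifP.
  rewrite gw; move: gw; rewrite mem_words => /eqP sg.
  have [->|Zg0] := eqVneq (Z wt st A B L g) 0; first by rewrite mul0r.
  have [->|Cg0] := eqVneq (colw wt st L false false g f) 0; first by rewrite mulr0.
  have [rgh gh] := colw_rank wt_conserve sg sf Cg0.
  have rlt : (rk g < rk f)%N.
    rewrite ltn_neqAle rgh andbT; apply/eqP => e.
    by move/eqP: gf; apply; apply: gh.
  apply: ler_pM; rewrite ?Z_ge0 ?colw_ge0 //; last exact: colw_bounded.
  apply: (le_trans (dec _ _ L0L sg rlt)).
  apply: ler_wpM2r; first by rewrite exprn_ge0 // ltW.
  by apply: ler_wpM2l => //; apply: ler_weXn2l => //; apply: ltnW.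
(* This is the sum of the geometric series with first term [c1]. Keeping exact partial sums below
   lets the induction on [d] telescope. *)
pose c2 := c1 / (1 - rate).
have r10 : 0 < 1 - rate by rewrite subr_gt0.
exists c2 => [|L L' /andP[L0L LL']]; first by rewrite divr_ge0 // ltW.
rewrite -(subnKC LL'); move: (L' - L)%N => d {L' LL'}.
suff /andP[-> le] : 0 <= Z wt st A B (L + d) (map isF st) - Z wt st A B L (map isF st)
    <= c2 * (rate ^+ L - rate ^+ (L + d)).
  apply: (le_trans le); apply: ler_wpM2l; first by rewrite divr_ge0 // ltW.
  by rewrite gerBl exprn_ge0 // ltW.
elim: d => [|d /andP[IH0 IH]]; first by rewrite addn0 !subrr mulr0 lexx.
have/andP[s0 s1] := step (L + d)%N (leq_trans L0L (leq_addr _ _)).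
rewrite addnS; set z := Z _ _ _ _ _ _ in s0 s1 *; set z1 := Z _ _ _ _ _ _ in IH0 IH s0 s1.
set z0 := Z _ _ _ _ _ _ in IH0 IH *.
have -> : z - z0 = (z - z1) + (z1 - z0) by ring.
rewrite addr_ge0 //=.
have -> : c2 * (rate ^+ L - rate ^+ (L + d).+1)
   = c1 * rate ^+ (L + d) + c2 * (rate ^+ L - rate ^+ (L + d)).
  by rewrite /c2 exprS; field; rewrite gt_eqF.
exact: lerD.
Qed.

End Decay.

(** * Uniform bounds on the vertex weights *)

Section Weights.
Variable C : numFieldType.

Lemma norm_ratio_le (n d c m p b : C) : 0 < p -> 0 <= c -> p <= c * `|d| ->
  `|n| <= m * b -> `|n / d| <= c * m * (b / p).
Proof.
move=> p0 c0 pd nb.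
have d0 : 0 < `|d|.
  rewrite lt_neqAle normr_ge0 andbT eq_sym; apply: contraTneq pd => ->.
  by rewrite mulr0 lt_geF.
rewrite normf_div ler_pdivrMr //; apply: (le_trans nb).
have -> : c * m * (b / p) * `|d| = m * b * (c * `|d| / p).
  by field; rewrite gt_eqF.
by rewrite ler_peMr ?(le_trans _ nb) // ler_pdivlMr // mul1r.
Qed.

(** Near [z] the lower bound [eps] suffices, and far from [z] the distance grows like the norm of
    [a]. This compares denominators with [1 + |a|] uniformly in the columns, although [a] may be
    unbounded. *)
Lemma le_scaled_dist (eps a z : C) : 0 < eps -> eps <= `|a - z| ->
  1 + `|a| <= (1 + (1 + `|z|) / eps) * `|a - z|.
Proof.
move=> e0 ed; have z0 : 0 <= 1 + `|z| by rewrite addr_ge0.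
rewrite mulrDl mul1r.
apply: (@le_trans _ _ (`|a - z| + (1 + `|z|))); last first.
  by rewrite lerD2l mulrAC ler_pdivlMr // ler_wpM2l.
rewrite addrCA lerD2l -[X in `|X| <= _](subrK z a).
exact: ler_normD.
Qed.

Lemma norm_sub_le (m a z : C) : 1 <= m -> `|a| <= m -> `|z - a| <= m * (1 + `|z|).
Proof.
move=> m1 am; rewrite (le_trans (ler_normB _ _)) // addrC mulrDr mulr1 lerD //.
by rewrite ler_peMl.
Qed.

Lemma norm_sub_le_prod (m a z : C) : 1 <= m ->
  `|a - z| <= m * ((1 + `|z|) * (1 + `|a|)).
Proof.
move=> m1; apply: (@le_trans _ _ ((1 + `|z|) * (1 + `|a|))); last first.
  by rewrite ler_peMl // mulr_ge0 ?addr_ge0.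
rewrite (le_trans (ler_normB _ _)) // -subr_ge0.
have -> : (1 + `|z|) * (1 + `|a|) - (`|a| + `|z|) = 1 + `|z| * `|a| by ring.
by rewrite addr_ge0 // mulr_ge0.
Qed.

(** The first factor comes from [le_scaled_dist] and handles the denominators; the second bounds the
    numerators. *)
Definition gauge_const (eps x r : C) : C :=
  (1 + (1 + `|x|) / eps) * (1 + `|x| + `|r ^- 2 * x|).

(** Up to constants the denominator is at least [p], and the numerators are at most [q], [p], [1] or
    [p * q]. The turn from left to top thus keeps a factor [q], while the turn from bottom to right
    gains [1 / p]; the vertical gauge [q ^+ v / q ^+ u] accounts for both. *)
Lemma W_gauge (y w th s eps : C) (u a v b : bool) :
  0 < eps -> eps <= `|s ^- 2 * y - w| ->
  let p := 1 + `|s ^- 2 * y| in let q := 1 + `|y| in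
  `|W w y th s u a v b|
    <= gauge_const eps w th * ((if b then q / p else 1) * (q ^+ v / q ^+ u)).
Proof.
rewrite /W /gauge_const; move: (s ^- 2) (th ^- 2) => S Q e0 ed.
set p := 1 + `|S * y|; set q := 1 + `|y|.
have := le_scaled_dist e0 ed; set c := 1 + _ / eps; set m := 1 + _ + _.
rewrite -/p => pd.
have [p0 q0] : 0 < p /\ 0 < q by rewrite !ltr_pwDl.
have [pN qN] : p != 0 /\ q != 0 by rewrite !gt_eqF.
have m1 : 1 <= m by rewrite /m -addrA lerDl addr_ge0.
have c1 : 1 <= c by rewrite lerDl divr_ge0 ?addr_ge0 // ltW.
have c0 : 0 <= c by rewrite (le_trans ler01).
have wm : `|w| <= m by rewrite /m addrAC lerDr addr_ge0.
have Qm : `|Q * w| <= m by rewrite /m lerDr addr_ge0.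
have rhs0 : 0 <= c * m * ((if b then q / p else 1) * (q ^+ v / q ^+ u)).
  have pw (e : bool) : 0 <= q ^+ e by rewrite exprn_ge0 // ltW.
  apply: mulr_ge0; first by rewrite mulr_ge0 // (le_trans ler01).
  by apply: mulr_ge0; [case: (b); rewrite // divr_ge0 // ltW | rewrite divr_ge0].
have frac n e Y : `|n| <= m * e -> e / p = Y -> `|n / (S * y - w)| <= c * m * Y.
  by move=> ne <-; apply: norm_ratio_le.
case: u a v b rhs0 => [] [] [] [] /= rhs0; rewrite ?normr0 //.
- by apply: (frac _ q); [rewrite distrC norm_sub_le | field; rewrite pN qN].
- by apply: (frac _ p); [rewrite norm_sub_le | field; rewrite pN qN].
- apply: (frac _ 1); last by field; rewrite pN qN.
  have -> : w * (Q - 1) = Q * w - w by ring.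
  by rewrite mulr1 (le_trans (ler_normB _ _)) // /m -addrA [leLHS]addrC lerDr.
- apply: (frac _ (q * p)); last by field; rewrite pN.
  have -> : y * (S - 1) = S * y - y by ring.
  exact: norm_sub_le_prod.
- by apply: (frac _ q); [rewrite norm_sub_le | field; rewrite pN].
- by rewrite normr1 divr1 !mulr1 mulr_ege1.
Qed.

(** The normalization cancels the common denominator and leaves [y - x], so that [q] replaces [p]
    below the fraction bar and the horizontal factor passes from paths to holes. *)
Lemma What_gauge (x y r s eps : C) (u a v b : bool) :
  0 < eps -> eps <= `|y - x| -> s ^- 2 * y - x != 0 ->
  let p := 1 + `|s ^- 2 * y| in let q := 1 + `|y| in
  `|What x y r s u a v b|
    <= gauge_const eps x r * ((if b then 1 else p / q) * (q ^+ v / q ^+ u)).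
Proof.
rewrite /What /W /gauge_const; move: (s ^- 2) (r ^- 2) => S P e0 ed Sx.
set p := 1 + `|S * y|; set q := 1 + `|y|.
have := le_scaled_dist e0 ed; set c := 1 + _ / eps; set m := 1 + _ + _.
rewrite -/q => qd.
have yx : y - x != 0 by rewrite -normr_gt0 (lt_le_trans e0).
have [p0 q0] : 0 < p /\ 0 < q by rewrite !ltr_pwDl.
have qN : q != 0 by rewrite gt_eqF.
have m1 : 1 <= m by rewrite /m -addrA lerDl addr_ge0.
have c1 : 1 <= c by rewrite lerDl divr_ge0 ?addr_ge0 // ltW.
have c0 : 0 <= c by rewrite (le_trans ler01).
have xm : `|x| <= m by rewrite /m addrAC lerDr addr_ge0.
have Pm : `|P * x| <= m by rewrite /m lerDr addr_ge0.
have rhs0 : 0 <= c * m * ((if b then 1 else p / q) * (q ^+ v / q ^+ u)).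
  have pw (e : bool) : 0 <= q ^+ e by rewrite exprn_ge0 // ltW.
  apply: mulr_ge0; first by rewrite mulr_ge0 // (le_trans ler01).
  by apply: mulr_ge0; [case: (b); rewrite // divr_ge0 // ltW | rewrite divr_ge0].
have frac n z e Y : z = n / (y - x) -> `|n| <= m * e -> e / q = Y -> `|z| <= c * m * Y.
  by move=> -> ne <-; apply: norm_ratio_le.
case: u a v b rhs0 => [] [] [] [] /= rhs0; rewrite ?mul0r ?normr0 //.
- apply: (frac (P * x - y) _ q); [by field; rewrite Sx yx| |by field].
  by rewrite distrC norm_sub_le.
- apply: (frac (S * y - P * x) _ p); [by field; rewrite Sx yx| |by field].
  exact: norm_sub_le.
- apply: (frac (x * (P - 1)) _ 1); [by field; rewrite Sx yx| |by field].
  have -> : x * (P - 1) = P * x - x by ring.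
  by rewrite mulr1 (le_trans (ler_normB _ _)) // /m -addrA [leLHS]addrC lerDr.
- apply: (frac (y * (S - 1)) _ (q * p)); [by field; rewrite Sx yx| |by field].
  have -> : y * (S - 1) = S * y - y by ring.
  exact: norm_sub_le_prod.
- by rewrite divff ?mulf_neq0 ?invr_eq0 // normr1 divr1 !mulr1 mulr_ege1.
- apply: (frac (S * y - x) _ p); [by field; rewrite Sx yx| |by field].
  exact: norm_sub_le.
Qed.

End Weights.

(** * Exchanging rows *)

Lemma norm_colw (C : numFieldType) (I : Type)
    (wt : I -> nat -> bool -> bool -> bool -> bool -> C) st i u t l r :
  `|colw wt st i u t l r|
    <= colw (fun k i u a v b => `|wt k i u a v b|) st i u t l r.
Proof.
elim: st l r u => [|k st IH] [|a l] [|b r] u; rewrite /colw /= ?normr_nat //.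
apply: (le_trans (ler_norm_sum _ _ _)); apply: ler_sum => v _.
by rewrite normrM ler_wpM2l.
Qed.

Lemma norm_Z (C : numFieldType) (I : Type)
    (wt : I -> nat -> bool -> bool -> bool -> bool -> C) st A B L h :
  `|Z wt st A B L h| <= Z (fun k i u a v b => `|wt k i u a v b|) st A B L h.
Proof.
elim: L h => [|L IH] h /=; first by rewrite normr_nat.
apply: (le_trans (ler_norm_sum _ _ _)); apply: ler_sum => g _.
by rewrite normrM ler_pM ?norm_colw.
Qed.

(** The order of [C] may be partial, but nonnegative values are real and hence comparable. *)
Lemma seq_max (C : numDomainType) (T : eqType) (f : T -> C) (s : seq T) x0 :
  (forall z, 0 <= f z) ->
  exists2 z, z \in x0 :: s & forall z', z' \in x0 :: s -> f z' <= f z.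
Proof.
move=> f0; elim: s => [|z s [z1 z1s max]].
  by exists x0; rewrite ?inE // => z'; rewrite inE => /eqP ->.
have [le|lt] := real_leP (ger0_real (f0 z)) (ger0_real (f0 z1)).
  exists z1 => [|z']; first by move: z1s; rewrite !inE => /orP[]->; rewrite ?orbT.
  rewrite !inE => /or3P[/eqP->|/eqP-> //|z's]; apply: max.
    exact: mem_head.
  by rewrite inE z's orbT.
exists z; first by rewrite !inE eqxx orbT.
move=> z'; rewrite !inE => /or3P[/eqP->|/eqP-> //|z's]; apply: le_trans (ltW lt);
  by apply: max; rewrite inE ?eqxx ?z's ?orbT.
Qed.

Lemma ord_max_ex (C : numDomainType) n (f : 'I_n -> C) :
  (0 < n)%N -> (forall z, 0 <= f z) -> exists z, forall z', f z' <= f z.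
Proof.
case: n f => // n f _ f0.
have [z _ max] := seq_max (enum 'I_n.+1) ord0 f0.
by exists z => z'; apply: max; rewrite inE mem_enum orbT.
Qed.

Lemma count0_nseq h : count id h = 0%N -> h = nseq (size h) false.
Proof. by elim: h => //= -[] h IH //= /IH <-. Qed.

Lemma count_size_nseq h : count id h = size h -> h = nseq (size h) true.
Proof.
elim: h => //= -[] h IH /= e; first by rewrite -IH //; case: e.
by move: (count_size id h); rewrite -[count _ _]add0n e ltnn.
Qed.

Lemma map_const (T S : Type) (a : S) (s : seq T) : map (fun=> a) s = nseq (size s) a.
Proof. by elim: s => //= ? ? ->. Qed.

Section Model.
Variables (C : numFieldType) (M N : nat).
Variables (x r : 'I_M -> C) (w theta : 'I_N -> C) (y s : nat -> C).

(* Row [inl p] carries the hatted weights of F, row [inr q] those of G. *)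
Definition rowwt (k : 'I_M + 'I_N) (i : nat) : bool -> bool -> bool -> bool -> C :=
  match k with
  | inl p => What (x p) (y i) (r p) (s i)
  | inr q => W (w q) (y i) (theta q) (s i)
  end.

Definition isF (k : 'I_M + 'I_N) : bool := if k is inl _ then true else false.

Let absw k i u a v b := `|rowwt k i u a v b|.

Lemma rowwt_conserve k i u a v b :
  rowwt k i u a v b != 0 -> (u + a = v + b :> nat)%N.
Proof.
by case: k => [p|q]; rewrite /= /What /W; case: u a v b => [] [] [] [];
  rewrite ?mul0r ?eqxx.
Qed.

Hypotheses (M0 : (0 < M)%N) (N0 : (0 < N)%N).
Variables (eps rho : C).
Hypothesis eps0 : 0 < eps.
Hypothesis rho01 : 0 < rho < 1.
Hypothesis sN0 : forall i, s i != 0.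
Hypothesis xw : forall p q, x p != w q.
Hypothesis SxN0 : forall p i, s i ^- 2 * y i - x p != 0.
Hypothesis Gden : forall q i, eps <= `|s i ^- 2 * y i - w q|.
Hypothesis Fden : forall p i, eps <= `|y i - x p|.
Hypothesis ratio : forall p q i,
  `|(y i - s i ^+ 2 * x p) / (y i - x p)
    * ((y i - w q) / (y i - s i ^+ 2 * w q))| <= rho.

Let yxN0 p i : y i - x p != 0.
Proof. by rewrite -normr_gt0 (lt_le_trans eps0). Qed.

Let SwN0 q i : s i ^- 2 * y i - w q != 0.
Proof. by rewrite -normr_gt0 (lt_le_trans eps0). Qed.

Lemma rowwt_fl k i : rowwt k i false (isF k) false (isF k) = 1.
Proof.
by case: k => [p|q] //=; rewrite /What /W divff // mulf_neq0 ?invr_eq0 ?yxN0 ?SxN0.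
Qed.

Let p i := 1 + `|s i ^- 2 * y i|.
Let q i := 1 + `|y i|.
Let p0 i : 0 < p i. Proof. by rewrite ltr_pwDl. Qed.
Let q0 i : 0 < q i. Proof. by rewrite ltr_pwDl. Qed.

Lemma rowwt_gauge : exists2 K, 0 < K & forall k i (u a v b : bool),
  `|rowwt k i u a v b|
    <= K * rowfac isF (q i / p i) (p i / q i) k b * (q i ^+ v / q i ^+ u).
Proof.
pose Kw := gauge_const eps.
have Kw0 x1 r1 : 0 <= Kw x1 r1.
  by rewrite mulr_ge0 ?addr_ge0 // divr_ge0 ?addr_ge0 // ltW.
(* The sum over all rows bounds the constant of each row, and the summand 1 makes it positive. *)
pose K := 1 + \sum_p Kw (x p) (r p) + \sum_q Kw (w q) (theta q).
have K0 : 0 < K by rewrite /K -addrA ltr_pwDl // addr_ge0 // sumr_ge0.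
have sum_ge n (f : 'I_n -> C) j : (forall j, 0 <= f j) -> f j <= \sum_j f j.
  by move=> f0; rewrite (bigD1 j) //= lerDl sumr_ge0.
exists K => // k i u a v b.
have fac0 : 0 <= rowfac isF (q i / p i) (p i / q i) k b.
  by rewrite /rowfac; case: isF; case: (b); rewrite ?divr_ge0 // ltW.
have pw0 : 0 <= q i ^+ v / q i ^+ u by rewrite divr_ge0 // exprn_ge0 // ltW.
case: k fac0 => [j|j] fac0 /=.
  apply: (le_trans (What_gauge (r j) u a v b eps0 (Fden j i) (SxN0 j i))).
  rewrite [leLHS]mulrA ler_wpM2r // /rowfac /= ler_wpM2r //.
  rewrite -/(Kw _ _) /K addrAC (le_trans (sum_ge _ (fun p => Kw (x p) (r p)) j _)) //.
  by rewrite lerDr addr_ge0 // sumr_ge0.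
apply: (le_trans (W_gauge (theta j) u a v b eps0 (Gden j i))).
rewrite [leLHS]mulrA ler_wpM2r // /rowfac /= ler_wpM2r //.
rewrite -/(Kw _ _) /K (le_trans (sum_ge _ (fun q => Kw (w q) (theta q)) j _)) //.
by rewrite lerDr addr_ge0 // sumr_ge0.
Qed.

(** The first number is the largest straight weight of a path among the rows of G, the second that
    of a hole among the rows of F. Their product is the ratio assumed to be small, taken at the
    maximizing pair of rows. *)
Lemma rowwt_straight i : exists ab : C * C,
  [/\ 0 <= ab.1, 0 <= ab.2, ab.1 * ab.2 <= rho
    & forall k b, `|rowwt k i false b false b| <= rowfac isF ab.1 ab.2 k b].
Proof.
have [j jmax] := @ord_max_ex _ _
  (fun q => `|rowwt (inr q) i false true false true|) N0 (fun=> normr_ge0 _).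
have [l lmax] := @ord_max_ex _ _
  (fun p => `|rowwt (inl p) i false false false false|) M0 (fun=> normr_ge0 _).
exists (`|rowwt (inr j) i false true false true|,
        `|rowwt (inl l) i false false false false|); split => //=.
  rewrite -normrM; apply: le_trans (ratio l j i).
  (* In terms of [y - s ^+ 2 * z], the path weight carries a factor [s i ^+ 2] and the hole weight
     its inverse; these cancel in the product. *)
  rewrite le_eqVlt; apply/orP; left; apply/eqP; congr `|_|.
  have ys z : s i ^- 2 * y i - z != 0 -> y i - s i ^+ 2 * z != 0.
    move=> nz; have -> : y i - s i ^+ 2 * z = s i ^+ 2 * (s i ^- 2 * y i - z) by field.
    by rewrite mulf_neq0 // expf_neq0.
  rewrite /What /W; field.
  by rewrite mulNr [x l * _]mulrC sN0 yxN0 !ys ?SwN0 ?SxN0.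
case=> [k|k] [].
- by move: (rowwt_fl (inl k) i) => /= ->; rewrite normr1.
- exact: lmax.
- exact: jmax.
- by rewrite /= normr1.
Qed.

(* The geometric rate makes an appeal to completeness unnecessary. *)
Definition conv (st : seq ('I_M + 'I_N)) A B L0 (l : C) : Prop :=
  exists2 c, 0 <= c & forall L, (L0 <= L)%N ->
    `|Z rowwt st A B L (map isF st) - l| <= c * rate rho ^+ L.

Section Boundary.
Variables (A B : nat -> bool) (L0 : nat).
Hypothesis A0 : forall i, (L0 <= i)%N -> A i = false.
Hypothesis B0 : forall i, (L0 <= i)%N -> B i = false.
Hypothesis AB : (\sum_(i < L0) A i = \sum_(i < L0) B i + M :> nat)%N.

Lemma model_decay st : count isF st = M ->
  (exists2 c, 0 <= c & forall L L', (L0 <= L <= L')%N ->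
     0 <= Z absw st A B L' (map isF st) - Z absw st A B L (map isF st)
       <= c * rate rho ^+ L)
  /\ forall h, size h = size st -> (rk h < rk (map isF st))%N ->
     exists2 c, 0 <= c & forall L, (L0 <= L)%N -> Z absw st A B L h <= c * rate rho ^+ L.
Proof.
move=> cF; have [K K0 gauge] := rowwt_gauge.
have [ab abP] := choice rowwt_straight.
have absw_conserve k i u a v b : absw k i u a v b != 0 -> (u + a = v + b :> nat)%N.
  by rewrite normr_eq0; apply: rowwt_conserve.
have absw_fl k i : absw k i false (isF k) false (isF k) = 1.
  by rewrite /absw rowwt_fl normr1.
have AB' : (\sum_(i < L0) A i = \sum_(i < L0) B i + count isF st :> nat)%N.
  by rewrite cF.
have absw_ge0 k i u a v b : 0 <= absw k i u a v b by exact: normr_ge0.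
have gab i : q i / p i * (p i / q i) = 1 by field; rewrite !gt_eqF.
have a0 i : 0 <= (ab i).1 by have [] := abP i.
have b0 i : 0 <= (ab i).2 by have [] := abP i.
have ab1 i : (ab i).1 * (ab i).2 <= rho by have [] := abP i.
have straight k i b : absw k i false b false b <= rowfac isF (ab i).1 (ab i).2 k b.
  by have [_ _ _] := abP i; apply.
split.
  exact: (Z_fl_tail absw_conserve absw_ge0 absw_fl K0 rho01 gab q0
            a0 b0 ab1 gauge straight A0 B0 AB').
move=> h sh rh.
have [c c0 dec] := Z_decay absw_conserve absw_ge0 K0 rho01 gab q0
            a0 b0 ab1 gauge straight A0 B0 AB'.
move: dec; set base := (_ + 1) => dec.
have b0' : 0 <= base.
  have/andP[rho0 rho1] := rho01.
  rewrite /base addr_ge0 //; apply: divr_ge0; last first.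
    by rewrite ltW // divr_gt0 // subr_gt0.
  by rewrite mulr_ge0 // exprn_ge0 // mulr_ge0 // ltW.
exists (c * base ^+ rk h) => [|L L0L]; first by rewrite mulr_ge0 // exprn_ge0.
exact: dec.
Qed.

(** The Yang-Baxter exchange holds up to a multiple of the state [e], in which the path leaves
    through the row of G. This state has lower rank than the final one, so the error decays
    geometrically. *)
Lemma conv_swap pre post j l z :
  count isF (pre ++ inl j :: inr l :: post) = M ->
  conv (pre ++ inl j :: inr l :: post) A B L0 z ->
  conv (pre ++ inr l :: inl j :: post) A B L0
       (z * ((x j - theta l ^- 2 * w l) / (x j - w l))).
Proof.
move=> cF [c1 c10 hz].
set st := pre ++ inl j :: _ in cF hz *.
set st' := pre ++ inr l :: inl j :: post.
have cF' : count isF st' = M by move: cF; rewrite /st /st' !count_cat.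
set e := map isF pre ++ true :: false :: map isF post.
have fst' : map isF st' = map isF pre ++ false :: true :: map isF post.
  by rewrite map_cat.
have fst : map isF st = e by rewrite map_cat.
have se : size e = size st' by rewrite !size_cat /= !size_map.
(* In [st'] the row of G lies below that of F, so [e] has this path one row lower than the final
   state. *)
have re : (rk e < rk (map isF st'))%N.
  rewrite fst' /e; elim: (map isF pre) => [|b h IH] /=; first by rewrite !addnS ltnS leqnn.
  have -> : count id (h ++ true :: false :: map isF post)
          = count id (h ++ false :: true :: map isF post) by rewrite !count_cat.
  by rewrite ltn_add2r.
have [_ /(_ e se re)[c2 c20 dec]] := model_decay cF'.
have xw0 : x j - w l != 0 by rewrite subr_eq0.
pose al := x j - theta l ^- 2 * w l; pose g := (1 - r j ^- 2) * x j.
exists ((`|al| * c1 + `|g| * c2) / `|x j - w l|).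
  by rewrite divr_ge0 // addr_ge0 // mulr_ge0.
move=> L L0L.
(* When a path leaves the crossing through the row of F only, just two entries remain: [x j - w l]
   in front of the final state of [st'], and [g] in front of [e]. *)
have : \sum_(a : bool) \sum_(b : bool)
    Z rowwt st' A B L (map isF pre ++ a :: b :: map isF post)
    * crossing (x j) (r j) (w l) (theta l) a b true false
  = al * Z rowwt st A B L e.
  apply: Z_swap; last by rewrite size_map.
  - by move=> i u t lg lf rf rg; apply: yang_baxter => //; apply: SwN0.
  - by case=> [] []; rewrite /= ?mul0r ?mul1r.
  - by rewrite size_map.
rewrite !big_bool /= !mulr0 -/e add0r addr0 => E.
rewrite fst'.
have -> : Z rowwt st' A B L (map isF pre ++ false :: true :: map isF post)
    - z * (al / (x j - w l))
    = (al * (Z rowwt st A B L e - z) - g * Z rowwt st' A B L e) / (x j - w l).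
  by rewrite mulrBr -E -/g; field.
clearbody al g.
rewrite normf_div ler_pdivrMr ?normr_gt0 // [leRHS]mulrAC divfK ?normr_eq0 //.
rewrite (le_trans (ler_normB _ _)) // [leRHS]mulrDl !normrM -!mulrA lerD // ler_wpM2l //.
  by rewrite -fst hz.
by rewrite (le_trans (norm_Z _ _ _ _ _ _)) // dec.
Qed.

(** Adjacent exchanges carry each row of F upwards over all rows of G, the uppermost row of F first;
    every exchange contributes one factor. *)
Lemma conv_sort pre post (js : seq 'I_M) (ls : seq 'I_N) z :
  count isF (pre ++ map inl js ++ map inr ls ++ post) = M ->
  conv (pre ++ map inl js ++ map inr ls ++ post) A B L0 z ->
  conv (pre ++ map inr ls ++ map inl js ++ post) A B L0
       (z * \prod_(j <- js) \prod_(l <- ls)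
              ((x j - theta l ^- 2 * w l) / (x j - w l))).
Proof.
have one p' j ls' p'' z' : count isF (p' ++ inl j :: map inr ls' ++ p'') = M ->
    conv (p' ++ inl j :: map inr ls' ++ p'') A B L0 z' ->
    conv (p' ++ map inr ls' ++ inl j :: p'') A B L0
      (z' * \prod_(l <- ls') ((x j - theta l ^- 2 * w l) / (x j - w l))).
  elim: ls' p' z' => [|l ls' IH] p' z' /= cF cz; first by rewrite big_nil mulr1.
  rewrite big_cons mulrA -cat_rcons; apply: IH; rewrite cat_rcons.
    by move: cF; rewrite !count_cat.
  exact: conv_swap.
elim: js pre z => [|j js IH] pre z /= cF cz; first by rewrite big_nil mulr1.
rewrite big_cons mulrC -mulrA mulrC; apply: one.
  by move: cF; rewrite !count_cat /= !count_cat; lia.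
by rewrite mulrC -cat_rcons; apply: IH; rewrite cat_rcons.
Qed.

(** Here the paths leave through the lowest rows. Paths never move down, so beyond [L0] the final
    state has no predecessor but itself, and the sequence is constant. *)
Lemma conv_FG (js : seq 'I_M) (ls : seq 'I_N) :
  conv (map inl js ++ map inr ls) A B L0
    (Z rowwt (map inl js ++ map inr ls) A B L0 (map isF (map inl js ++ map inr ls))).
Proof.
set st := map inl js ++ _; exists 0 => // L /subnKC <-; rewrite mul0r.
suff -> : Z rowwt st A B (L0 + (L - L0)) (map isF st) = Z rowwt st A B L0 (map isF st).
  by rewrite subrr normr0.
elim: (L - L0)%N => [|d IH]; first by rewrite addn0.
rewrite addnS /= A0 ?B0 ?leq_addr //.
rewrite (bigD1_seq (map isF st)) ?mem_words ?size_map ?words_uniq //=.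
rewrite IH colw_fl; [rewrite mulr1|exact: rowwt_conserve|exact: rowwt_fl].
rewrite big1_seq ?addr0 // => h /andP[hfl]; rewrite mem_words => /eqP sh.
rewrite (_ : colw _ _ _ _ _ _ _ = 0) ?mulr0 //.
apply: contrapT => /eqP nz; move/eqP: hfl; apply.
have fE : map isF st = nseq (size js) true ++ nseq (size ls) false.
  rewrite map_cat -!map_comp (eq_map (g := fun=> true)) //.
  by rewrite (eq_map (f := isF \o inr) (g := fun=> false)) // !map_const.
have s1 : size (take (size js) h) = size (map inl js : seq ('I_M + 'I_N)).
  by rewrite size_map size_takel // sh size_cat size_map leq_addr.
have s2 : size (drop (size js) h) = size (map inr ls : seq ('I_M + 'I_N)).
  by rewrite size_map size_drop sh size_cat !size_map addKn.
have cT n : count id (nseq n true) = n by rewrite count_nseq mul1n.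
have cN n : count id (nseq n false) = 0%N by rewrite count_nseq.
(* The column is cut between the rows of F and of G. Conservation above the cut empties the edge [v]
   and the G part of [h]; below it, every row of F must then carry a path. *)
move: nz; rewrite -[h](cat_take_drop (size js)) fE /st colw_cat ?s1 ?size_map ?size_nseq //.
move=> /big_bool_neq0[v]; rewrite mulf_eq0 negb_or => /andP[].
move=> /(colw_conserve rowwt_conserve s1); rewrite size_map size_nseq => /(_ erefl) e1.
move=> /(colw_conserve rowwt_conserve s2); rewrite size_map size_nseq => /(_ erefl) e2.
move: e1 e2; rewrite cT cN !add0n => e1 /eqP.
rewrite addn_eq0 => /andP[/eqP v0 /eqP e2].
rewrite (count0_nseq e2) (count_size_nseq (h := take _ _)) ?s1 ?s2 ?size_map //.
by rewrite e1 v0.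
Qed.
End Boundary.
End Model.

(** * Path configurations as transfer matrices *)

Lemma colw_nth (C : fieldType) (I : Type) (x0 : I)
    (wt : I -> nat -> bool -> bool -> bool -> bool -> C) st i u t l r :
  size l = size st -> size r = size st ->
  colw wt st i u t l r
  = \sum_(v <- words (size st).+1 | (nth false v 0 == u) && (nth false v (size st) == t))
      \prod_(0 <= j < size st)
        wt (nth x0 st j) i (nth false v j) (nth false l j) (nth false v j.+1) (nth false r j).
Proof.
elim: st l r u => [|k st IH] [|a l] [|b r] //= u.
  move=> _ _; rewrite big_mkcond (big_wordsS 0) big_bool !big_words0 /=.
  rewrite !big_geq // /colw.
  by case: u; case: t; rewrite /= ?addr0 ?add0r.
move=> [sl] [sr]; rewrite colw_cons.
rewrite [RHS]big_mkcond (big_wordsS (size st).+1) [RHS]big_bool /=.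
under [LHS]eq_bigr do rewrite IH // mulr_sumr big_mkcond.
have E b' : \sum_(h <- words (size st).+1)
    (if (b' == u) && (nth false h (size st) == t) then
       \prod_(0 <= j < (size st).+1)
         wt (nth x0 (k :: st) j) i (nth false (b' :: h) j) (nth false (a :: l) j)
           (nth false h j) (nth false (b :: r) j) else 0)
  = (b' == u)%:R * \sum_(v : bool) \sum_(h <- words (size st).+1)
     (if (nth false h 0 == v) && (nth false h (size st) == t) then
        wt k i u a v b * \prod_(0 <= j < size st)
         wt (nth x0 st j) i (nth false h j) (nth false l j) (nth false h j.+1) (nth false r j)
      else 0).
  case: eqP => [->|_]; last by rewrite mul0r big1.
  rewrite mul1r exchange_big; apply: eq_bigr => h _ /=.
  rewrite big_bool /=; case: eqP => _; rewrite ?andbT ?andbF ?addr0 //.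
  rewrite big_nat_recl //=.
  by case: (nth false h 0); rewrite ?addr0 ?add0r.
by rewrite !E; case: u {E}; rewrite /= ?mul0r ?addr0 ?add0r mul1r.
Qed.

Lemma colw_map (C : fieldType) (I J : Type) (f : I -> J)
    (wt : J -> nat -> bool -> bool -> bool -> bool -> C) st i u t l r :
  colw wt (map f st) i u t l r = colw (wt \o f) st i u t l r.
Proof.
elim: st l r u => [|k st IH] [|a l] [|b r] //= u; rewrite !colw_cons.
by apply: eq_bigr => v _; rewrite IH.
Qed.

Lemma Z_map (C : fieldType) (I J : Type) (f : I -> J)
    (wt : J -> nat -> bool -> bool -> bool -> bool -> C) st A B L h :
  Z wt (map f st) A B L h = Z (wt \o f) st A B L h.
Proof.
elim: L h => [|L IH] h /=; rewrite size_map //.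
by apply: eq_bigr => g _; rewrite IH colw_map.
Qed.

Section Configs.
Variables (C : fieldType) (k : nat).
Variable wt : 'I_k -> nat -> bool -> bool -> bool -> bool -> C.
Hypothesis wt_conserve :
  forall j i u a v b, wt j i u a v b != 0 -> (u + a = v + b :> nat)%N.

Definition colweight (c : config k) (i : nat) : C :=
  \prod_(j < k) wt j i (vbot c i j) (hleft c i j) (vtop c i j) (hright c i j).

(* The horizontal edges are continued constantly to the right of the first [L]
   columns, so that these columns determine the configuration. *)
Definition truncated (A B : nat -> bool) (L : nat) (h : seq bool) (c : config k) :=
  [/\ forall i, (i < L)%N -> c.1 i ord0 = A i /\ c.1 i ord_max = B i,
      forall j, c.2 0%N j = false,
      forall i j, (L <= i)%N -> c.1 i j = false,
      forall i j, (L <= i)%N -> c.2 i j = nth false h j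
    & forall i j, (i < L)%N ->
        (vbot c i j + hleft c i j)%N = (vtop c i j + hright c i j)%N :> nat].

(** Inserts column [L] with vertical edges [v]; further right there are no vertical paths and [h] is
    continued, as [truncated] demands. *)
Definition snoc (L : nat) (h v : seq bool) (c : config k) : config k :=
  (fun i j => if (i < L)%N then c.1 i j else if i == L then nth false v j else false,
   fun i j => if (i <= L)%N then c.2 i j else nth false h j).

Definition compatible (a b : bool) (g v h : seq bool) : bool :=
  [&& nth false v 0 == a, nth false v k == b
    & [forall j : 'I_k,
        nth false v j + nth false g j == nth false v j.+1 + nth false h j :> nat]%N].

Fixpoint enum_truncated (A B : nat -> bool) (L : nat) (h : seq bool) : seq (config k) :=
  if L is L'.+1 then
    [seq snoc L' h gv.2 c
      | gv <- [seq gv <- [seq (g, v) | g <- words k, v <- words k.+1]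
                | compatible (A L') (B L') gv.1 gv.2 h],
        c <- enum_truncated A B L' gv.1]
  else if h == nseq k false then [:: (fun _ _ => false, fun _ _ => false)] else [::].

Lemma nth_codom n (f : 'I_n -> bool) (j : 'I_n) : nth false [seq f j | j <- enum 'I_n] j = f j.
Proof. by rewrite (nth_map j) ?nth_ord_enum // size_enum_ord. Qed.

Lemma eq_nth_ord n (g g' : seq bool) : size g = n -> size g' = n ->
  (forall j : 'I_n, nth false g j = nth false g' j) -> g = g'.
Proof.
move=> sg sg' e; apply: (@eq_from_nth _ false); rewrite sg ?sg' // => j jn.
exact: (e (Ordinal jn)).
Qed.

Lemma mem_enum_truncated A B L h c : size h = k ->
  (c \in enum_truncated A B L h) <-> truncated A B L h c.
Proof.
elim: L h c => [|L IH] h c sh /=.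
  case: (h =P _) => [->|hn]; rewrite ?inE; split.
  - by move=> /eqP ->; split => //= i j _; rewrite nth_nseq if_same.
  - case=> _ _ c1 c2 _; apply/eqP; case: c c1 c2 => c1 c2 /= e1 e2.
    congr (_, _); apply/funext => i; apply/funext => j; first exact: e1.
    by rewrite e2 // nth_nseq if_same.
  - by [].
  - case=> _ h0 _ c2 _; case: hn; apply: (eq_nth_ord sh); rewrite ?size_nseq // => j.
    by rewrite -(c2 0%N) // h0 nth_nseq if_same.
split.
  case/allpairsPdep => -[g v] [c' [+ c'g ->]].
  rewrite mem_filter /= => /andP[/and3P[/eqP vA /eqP vB /forallP vgh]].
  move=> /allpairsP[[g' v'] /= []]; rewrite !mem_words => sg sv [? ?]; subst g' v'.
  have [cAB c0 c1 c2 cc] := (IH _ _ (eqP sg)).1 c'g.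
  split.
  - move=> i; rewrite ltnS leq_eqVlt /= => /orP[/eqP->|iL]; last by rewrite iL; apply: cAB.
    by rewrite ltnn eqxx.
  - by move=> j /=; apply: c0.
  - by move=> i j Li /=; rewrite ltnNge (ltnW Li) /= gtn_eqF.
  - by move=> i j Li /=; rewrite leqNgt Li.
  - move=> i j; rewrite ltnS leq_eqVlt => /orP[/eqP->|iL].
      rewrite /vbot /vtop /hleft /hright /= ltnn eqxx leqnn c2 //.
      by move/eqP: (vgh j).
    rewrite /vbot /vtop /hleft /hright /= iL (ltnW iL); exact: cc.
case=> cAB c0 c1 c2 cc.
(* [g] and [v] are the left and the vertical edges of column [L]; [c'] below is [c] with this column
   erased. *)
pose g := [seq c.2 L j | j <- enum 'I_k].
pose v := [seq c.1 L j | j <- enum 'I_k.+1].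
have sg : size g = k by rewrite size_map size_enum_ord.
have sv : size v = k.+1 by rewrite size_map size_enum_ord.
have nv (j : 'I_k.+1) : nth false v j = c.1 L j by apply: nth_codom.
have ng (j : 'I_k) : nth false g j = c.2 L j by apply: nth_codom.
pose c' : config k := (fun i j => if (i < L)%N then c.1 i j else false,
                       fun i j => if (i <= L)%N then c.2 i j else nth false g j).
apply/allpairsPdep; exists (g, v), c'; split.
- rewrite mem_filter; apply/andP; split; last first.
    by apply/allpairsP; exists (g, v); rewrite !mem_words /= sg sv !eqxx.
  have [cA cB] := cAB L (ltnSn _).
  apply/and3P; split; first by rewrite -cA -(nv ord0).
    by rewrite -cB -(nv ord_max).
  apply/forallP => j; have := cc L j (ltnSn _); rewrite /vbot /vtop /hleft /hright.
  by rewrite -!nv -ng (c2 L.+1) //= => ->.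
- apply/IH; first by rewrite size_map size_enum_ord.
  split => [i iL|j|i j Li|i j Li|i j iL] /=.
  + by rewrite iL; apply: cAB; apply: ltnW.
  + exact: c0.
  + by rewrite ltnNge Li.
  + by case: leqP => // iL; rewrite (_ : i = L) ?ng //; apply/eqP; rewrite eqn_leq iL.
  + rewrite /vbot /vtop /hleft /hright /= iL (ltnW iL); exact: cc (ltnW iL).
- rewrite [LHS]surjective_pairing /snoc /c' /=; congr (_, _); apply/funext => i; apply/funext => j.
    case: ltngtP => // [Li|->]; [exact: c1 | by rewrite nv].
  by case: leqP => // Li; rewrite c2.
Qed.

Lemma enum_truncated_uniq A B L h : size h = k -> uniq (enum_truncated A B L h).
Proof.
elim: L h => [|L IH] h sh /=; first by case: eqP.
have szs gv : gv \in [seq gv <- [seq (g, v) | g <- words k, v <- words k.+1]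
                | compatible (A L) (B L) gv.1 gv.2 h] -> size gv.1 = k /\ size gv.2 = k.+1.
  rewrite mem_filter => /andP[_ /allpairsP[[g v] /= []]].
  by rewrite !mem_words => /eqP sg /eqP sv ->.
apply: allpairs_uniq_dep.
- rewrite filter_uniq // allpairs_uniq ?words_uniq //.
  by move=> [? ?] [? ?] _ _ /= [-> ->].
- by move=> gv /szs[sg _]; apply: IH.
move=> X X' /allpairsPdep[[g v] [c [/szs[/= sg sv] + ->]]].
move=> + /allpairsPdep[[g' v'] [c' [/szs[/= sg' sv'] + ->]]] /=.
move=> /(mem_enum_truncated _ _ _ _ sg)[_ _ c1 c2 _].
move=> /(mem_enum_truncated _ _ _ _ sg')[_ _ c1' c2' _].
move=> [e1 e2].
have e1' i j := congr1 (fun f => f i j) e1.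
have e2' i j := congr1 (fun f => f i j) e2.
have gg : g = g'.
  apply: (eq_nth_ord sg sg') => j.
  by have := e2' L j; rewrite leqnn c2 // c2'.
have vv : v = v'.
  by apply: (eq_nth_ord sv sv') => j; have := e1' L j; rewrite ltnn eqxx.
subst g' v'; congr (Tagged _ _).
case: c c' c1 c2 c1' c2' e1' e2' {e1 e2} => d1 d2 [d1' d2'] /= c1 c2 c1' c2' e1 e2.
congr (_, _); apply/funext => i; apply/funext => j.
  by case: (ltnP i L) => Li; [have := e1 i j; rewrite Li | rewrite c1 // c1'].
by case: (leqP i L) => Li; [have := e2 i j; rewrite Li | rewrite c2 ?c2' // ltnW].
Qed.

Lemma sum_enum_truncated A B L h : size h = k ->
  \sum_(c <- enum_truncated A B L h) \prod_(0 <= i < L) colweight c i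
  = Z wt (enum 'I_k) A B L h.
Proof.
elim: L h => [|L IH] h sh.
  rewrite /= size_enum_ord; case: eqP => _; last by rewrite big_nil.
  by rewrite big_seq1 big_geq.
rewrite [enum_truncated _ _ _ _]/= big_allpairs_dep big_filter big_mkcond big_allpairs /=.
rewrite size_enum_ord; apply: eq_big_seq => g; rewrite mem_words => /eqP sg.
rewrite -IH // big_distrl /=.
have colE : colw wt (enum 'I_k) L (A L) (B L) g h
    = \sum_(v <- words k.+1 | compatible (A L) (B L) g v h)
        \prod_(j < k) wt j L (nth false v j) (nth false g j) (nth false v j.+1) (nth false h j).
  (* ['I_k] may be empty, so the rows are relabelled by their weight functions, which provides the
     default row for [colw_nth]. *)
  have szE : size (map wt (enum 'I_k)) = k by rewrite size_map size_enum_ord.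
  rewrite -(colw_map wt (fun f => f)).
  rewrite (@colw_nth _ _ (fun _ _ _ _ _ => 0)) szE //.
  rewrite big_mkcond [RHS]big_mkcond; apply: eq_bigr => v _.
  rewrite /compatible; case: eqP => //= _; case: eqP => //= _.
  rewrite big_mkord; under [LHS]eq_bigr => j _.
    rewrite (nth_map j) ?size_enum_ord // nth_ord_enum; over.
  (* A vertex that violates conservation has weight 0, so the enumeration may omit its column. *)
  case: ifPn => // /forallPn[j nj]; rewrite (bigD1 j) //=.
  suff -> : wt j L (nth false v j) (nth false g j) (nth false v j.+1) (nth false h j) = 0.
    by rewrite mul0r.
  by apply: contrapT => /eqP /wt_conserve /eqP; apply/negP.
under [RHS]eq_bigr do rewrite colE mulr_sumr big_mkcond.
rewrite [RHS]exchange_big /=; apply: eq_big_seq => v; rewrite mem_words => /eqP sv.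
case: ifP => // _; last by rewrite big1.
apply: eq_big_seq => c /(mem_enum_truncated _ _ _ _ sg)[_ _ _ c2 _].
rewrite big_nat_recr //=; congr (_ * _).
  apply: eq_big_nat => i /= iL; apply: eq_bigr => j _.
  by rewrite /vbot /vtop /hleft /hright /= iL (ltnW iL).
apply: eq_bigr => j _.
by rewrite /vbot /vtop /hleft /hright /= ltnn eqxx leqnn c2.
Qed.

End Configs.

Lemma fsbig_nat_widen (R : Type) (idx : R) (op : Monoid.com_law idx) (f : nat -> R) L :
  (forall i, (L <= i)%N -> f i = idx) ->
  \big[op/idx]_(i \in [set: nat]) f i = \big[op/idx]_(0 <= i < L) f i.
Proof.
move=> f1; rewrite big_mkord fsbig_ord; apply/esym/fsbig_widen => // i /= [_ /negP].
by rewrite -leqNgt => Li; apply: f1.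
Qed.

Lemma all_eq_of_sum k (b : 'I_k -> bool) (e : bool) :
  (\sum_(j < k) b j = k * e)%N -> forall j, b j = e.
Proof.
case: e => [|/eqP]; last by rewrite muln0 sum_nat_eq0 => /forallP b0 j; move: (b0 j); case: (b j).
rewrite muln1 => sb j; apply: contrapT => /negP/negbTE bj; have : (\sum_(j < k) b j < k)%N.
  rewrite -[ltnRHS]card_ord -sum1_card (bigD1 j) // [ltnRHS](bigD1 j) //= bj ltnS.
  by apply: leq_sum => i _; case: (b i).
by rewrite sb ltnn.
Qed.

(** Beyond the boundary paths, conservation summed over a column keeps the number of horizontal
    paths constant. It equals its value far to the right, 0 or [k], which determines every
    horizontal edge from column [L] on. *)
Lemma configs_truncated k (A B : seq nat) (e : bool) L (c : config k) :
  (forall i, (L <= i)%N -> i.+1 \notin A) -> (forall i, (L <= i)%N -> i.+1 \notin B) ->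
  @configs k A B e c <->
  truncated (fun i => i.+1 \in A) (fun i => i.+1 \in B) L (nseq k e) c.
Proof.
move=> AL BL; have ne (j : 'I_k) : nth false (nseq k e) j = e by rewrite nth_nseq ltn_ord.
split; last first.
  case=> cAB c0 c1 c2 cc; split => //.
  - by move=> i; case: (ltnP i L) => Li; [have [] := cAB i Li | rewrite c1 // (negbTE (AL _ Li))].
  - by move=> i; case: (ltnP i L) => Li; [have [] := cAB i Li | rewrite c1 // (negbTE (BL _ Li))].
  - by exists L => // i /= Li j; rewrite c2.
  - move=> i j; case: (ltnP i L) => Li; first exact: cc.
    by rewrite /vbot /vtop /hleft /hright !c1 // !c2 // ltnW.
case=> cA cB c0 [n _ cn] cc.
have step i : (L <= i)%N -> (\sum_(j < k) c.2 i j = \sum_(j < k) c.2 i.+1 j)%N.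
  move=> Li; have : (\sum_(j < k) (vbot c i j + hleft c i j)
                     = \sum_(j < k) (vtop c i j + hright c i j))%N.
    by apply: eq_bigr.
  rewrite !big_split /=; suff -> : (\sum_(j < k) vbot c i j = \sum_(j < k) vtop c i j)%N.
    by move/addnI.
  have : (\sum_(j < k.+1) c.1 i j = \sum_(j < k.+1) c.1 i j)%N by [].
  rewrite {1}big_ord_recr big_ord_recl /= cA cB (negbTE (AL _ Li)) (negbTE (BL _ Li)).
  by rewrite addn0 add0n.
have far i d : (L <= i)%N -> (\sum_(j < k) c.2 i j = \sum_(j < k) c.2 (i + d) j)%N.
  move=> Li; elim: d => [|d ->]; first by rewrite addn0.
  by rewrite addnS step // (leq_trans Li) // leq_addr.
have c2 i j : (L <= i)%N -> c.2 i j = e.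
  move=> Li; apply: (all_eq_of_sum (b := c.2 i)).
  rewrite (far i n Li) (eq_bigr (fun=> nat_of_bool e)) ?sum_nat_const ?card_ord // => l _.
  by rewrite cn //= leq_addl.
split => //.
(* Equal horizontal edges on both sides make the vertical state pass unchanged through each row,
   starting from an empty bottom edge. *)
- move=> i j Li; case: j => j jk; elim: j jk => [|j IH] jk.
    rewrite (_ : Ordinal jk = ord0) ?cA; last exact: val_inj.
    exact/negbTE/AL.
  have jk' : (j < k)%N by [].
  have := cc i (Ordinal jk').
  rewrite /vbot /vtop /hleft /hright !c2 ?(leqW Li) // => /addIn.
  rewrite (_ : widen_ord _ _ = Ordinal (leqW jk')) ?IH; last exact: val_inj.
  rewrite (_ : lift ord0 _ = Ordinal jk); last exact: val_inj.
  by case: (c.1 _ _).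
- by move=> i j Li; rewrite c2 // ne.
Qed.

(** Beyond column [L] every vertex has empty vertical edges and horizontal edges [e], so its weight
    is 1 by hypothesis. *)
Lemma sum_configs (C : fieldType) k
    (wt : C -> C -> C -> C -> bool -> bool -> bool -> bool -> C)
    (x : 'I_k -> C) y (r : 'I_k -> C) s (A B : seq nat) e L :
  let wt' j i := wt (x j) (y i) (r j) (s i) in
  (forall j i u a v b, wt' j i u a v b != 0 -> (u + a = v + b :> nat)%N) ->
  (forall j i, wt' j i false e false e = 1) ->
  (forall i, (L <= i)%N -> i.+1 \notin A) -> (forall i, (L <= i)%N -> i.+1 \notin B) ->
  \sum_(c \in @configs k A B e) config_weight wt x y r s c
  = Z wt' (enum 'I_k) (fun i => i.+1 \in A) (fun i => i.+1 \in B) L (nseq k e).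
Proof.
move=> wt' cons one AL BL.
have sn : size (nseq k e) = k by rewrite size_nseq.
rewrite -(sum_enum_truncated cons _ _ _ sn).
rewrite [RHS](fsbig_seq (idx := 0)) ?enum_truncated_uniq //.
rewrite (_ : [set` _] = @configs k A B e); last first.
  apply/seteqP; split => c /=.
    by move=> /(mem_enum_truncated _ _ _ _ sn) ?; apply/(configs_truncated _ _ AL BL).
  by move=> /(configs_truncated _ _ AL BL) ?; apply/(mem_enum_truncated _ _ _ _ sn).
apply: eq_fsbigr => c /set_mem /(configs_truncated _ _ AL BL)[_ _ c1 c2 _].
apply: fsbig_nat_widen => i Li; apply: big1 => j _.
rewrite /vbot /vtop /hleft /hright !c1 // !c2 ?(leqW Li) // nth_nseq ltn_ord; exact: one.
Qed.

(** * Signatures as finite sets of positions *)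

Lemma eq_positions_cons a l (h : sorted geq (a :: l)) (h' : sorted geq l) :
  positions (exist _ (a :: l) h)
  = (a + (size l).+1)%N :: positions (exist _ l h').
Proof.
rewrite /positions /nparts /= subn0; congr (_ :: _).
rewrite -[1%N]addn0 iotaDl -map_comp; apply: eq_map => j /=.
by rewrite add1n /= addnS subSS.
Qed.

Lemma size_positions nu : size (positions nu) = nparts nu.
Proof. by rewrite size_map size_iota. Qed.

Lemma positions_sorted nu :
  sorted (fun a b => b < a)%N (positions nu) /\ all (leq 1) (positions nu).
Proof.
case: nu; elim => [//|a l IH] h.
have h' : sorted geq l by exact: path_sorted h.
rewrite (eq_positions_cons h h') /=; have [srt pos] := IH h'.
rewrite pos andbT addnS; split => //.
case: l h h' {IH} srt pos => // b l h h'; case/andP: (h) => ba hl srt _.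
rewrite (eq_positions_cons h' (path_sorted hl)) /= in srt *.
by rewrite srt andbT; move: ba; rewrite /= /geq /=; lia.
Qed.

Lemma positions_inj nu nu' : positions nu = positions nu' -> nu = nu'.
Proof.
move=> e; apply: val_inj; case: nu nu' e => l h [l' h'] /=.
elim: l l' h h' => [|a l IH] [|a' l'] h h' //.
have hl : sorted geq l by exact: path_sorted h.
have hl' : sorted geq l' by exact: path_sorted h'.
rewrite (eq_positions_cons h hl) (eq_positions_cons h' hl') => -[e1 /IH e2].
by move: e1; rewrite e2 => /addIn ->.
Qed.

Lemma positions_surj (p : seq nat) :
  sorted (fun a b => b < a)%N p -> all (leq 1) p -> exists nu, positions nu = p.
Proof.
elim: p => [|a p IH] /= srt pos; first by exists (exist _ [::] isT).
have /andP[a1 pos1] := pos.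
have [[l h] e] := IH (path_sorted srt) pos1.
have sl : size l = size p by rewrite -e size_positions.
(* This makes the truncated subtraction [a - (size l).+1] exact and the new part at least as large
   as the next one. *)
have bnd b m : l = b :: m -> (b + size l < a)%N.
  move=> lE; subst l; move: srt; rewrite -e (eq_positions_cons h (path_sorted h)) /=.
  by case/andP.
have h' : sorted geq ((a - (size l).+1)%N :: l).
  case: l h bnd {e sl} => [|b l] //= -> bnd; rewrite andbT.
  by have := bnd b l erefl; rewrite /geq /=; lia.
exists (exist (fun l : seq nat => sorted geq l) _ h'); rewrite (eq_positions_cons h' h) e subnK //.
by case: l bnd {h e sl h'} => [|b l] // /(_ b l erefl); lia.
Qed.

(** The boundary condition given by [nu]: columns count from 0, positions from 1. *)
Definition bits (nu : signature) (i : nat) : bool := i.+1 \in positions nu.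

Lemma bits_inj nu nu' : bits nu =1 bits nu' -> nu = nu'.
Proof.
move=> e; apply: positions_inj.
have [s1 p1] := positions_sorted nu; have [s2 p2] := positions_sorted nu'.
apply: (irr_sorted_eq (leT := fun a b => (b < a)%N)) => //.
- by move=> a b c /= ab ca; apply: ltn_trans ab.
- by move=> a /=; rewrite ltnn.
case=> [|i]; last exact: e.
by apply/idP/idP => [/(allP p1)|/(allP p2)].
Qed.

Definition bounded (L : nat) (nu : signature) : Prop :=
  forall i, (L <= i)%N -> bits nu i = false.

Lemma bounded_ex nu : exists L, bounded L nu.
Proof.
exists (\max_(p <- positions nu) p) => i Li; apply/negbTE/negP => ip.
have := @leq_bigmax_seq _ (positions nu) xpredT id _ ip isT.
by rewrite leqNgt ltnS Li.
Qed.

Lemma boundedW L L' nu : (L <= L')%N -> bounded L nu -> bounded L' nu.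
Proof. by move=> LL b i L'i; apply: b; apply: leq_trans L'i. Qed.

Lemma sum_bits L nu : bounded L nu -> (\sum_(i < L) bits nu i = nparts nu)%N.
Proof.
move=> b; rewrite -size_positions -(big_mkord xpredT (fun i => bits nu i : nat)).
transitivity (\sum_(p <- [seq i.+1 | i <- iota 0 L] | p \in positions nu) 1)%N.
  rewrite big_map /index_iota subn0 [RHS]big_mkcond.
  by apply: eq_bigr => i _; rewrite /bits; case: ifP.
rewrite -big_filter sum1_size; apply: perm_size; apply: uniq_perm.
- by rewrite filter_uniq // (map_inj_uniq succn_inj) iota_uniq.
- apply: (@sorted_uniq _ (fun a b => b < a)%N); last by have [] := positions_sorted nu.
    by move=> a c d /= ac da; apply: ltn_trans ac.
  by move=> a /=; rewrite ltnn.
move=> p; rewrite mem_filter; case pp: (p \in positions nu) => //=.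
have [_ /allP/(_ p pp)] := positions_sorted nu; case: p pp => // p pp _.
rewrite (mem_map succn_inj) mem_iota /= ltnNge; apply/negP => Lp.
by move: (b p Lp); rewrite /bits pp.
Qed.

Lemma bits_surj V : exists nu, bits nu =1 nth false V.
Proof.
pose p := rev [seq i.+1 | i <- iota 0 (size V) & nth false V i].
have srt : sorted (fun a b => b < a)%N p.
  rewrite rev_sorted sorted_map; apply: sorted_filter; first exact: ltn_trans.
  exact: iota_ltn_sorted.
have pos : all (leq 1) p by rewrite all_rev all_map; apply/allP.
have [nu e] := positions_surj srt pos; exists nu => i.
rewrite /bits e mem_rev (mem_map succn_inj) mem_filter mem_iota /= add0n.
by case: (ltnP i (size V)) => iV; rewrite ?andbT // nth_default.
Qed.

(** * Summation over signatures *)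

Definition sig_of (V : seq bool) : signature := projT1 (cid (bits_surj V)).

Lemma bits_sig_of V : bits (sig_of V) = nth false V.
Proof. by apply/funext; rewrite /sig_of; case: cid. Qed.

Definition sigs (L : nat) : seq signature := map sig_of (words L).

Lemma mem_sigs L nu : (nu \in sigs L) <-> bounded L nu.
Proof.
split=> [/mapP[V]|b].
  rewrite mem_words => /eqP sV -> i Li.
  by rewrite bits_sig_of nth_default // sV.
apply/mapP; exists (mkseq (bits nu) L); first by rewrite mem_words size_mkseq.
apply: bits_inj => i; rewrite bits_sig_of.
by case: (ltnP i L) => iL; [rewrite nth_mkseq | rewrite nth_default ?size_mkseq // b].
Qed.

Lemma sigs_uniq L : uniq (sigs L).
Proof.
rewrite map_inj_in_uniq ?words_uniq // => V V'.
rewrite !mem_words => /eqP sV /eqP sV' e.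
apply: (@eq_from_nth _ false); rewrite sV ?sV' // => i _.
by rewrite -!bits_sig_of e.
Qed.

Lemma sum_subset (V : nmodType) (T : eqType) (s s' : seq T) (F : T -> V) :
  uniq s -> uniq s' -> {subset s <= s'} ->
  \sum_(i <- s') F i = \sum_(i <- s) F i + \sum_(i <- s' | i \notin s) F i.
Proof.
move=> us us' ss'; rewrite (bigID (mem s)) /=; congr (_ + _).
rewrite -big_filter; apply: perm_big; apply: uniq_perm; rewrite ?filter_uniq //.
by move=> i; rewrite mem_filter andb_idr //; apply: ss'.
Qed.

Section Summation.
Variables (C : numFieldType) (I : Type) (isF : I -> bool).
Variable wt : I -> nat -> bool -> bool -> bool -> bool -> C.
Let absw k i u a v b := `|wt k i u a v b|.
Hypothesis wt_conserve :
  forall k i u a v b, wt k i u a v b != 0 -> (u + a = v + b :> nat)%N.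
Hypothesis wt_fl : forall k i, wt k i false (isF k) false (isF k) = 1.
Variables (st1 st2 : seq I) (A B : nat -> bool) (L0 : nat).
Hypothesis A0 : forall i, (L0 <= i)%N -> A i = false.
Hypothesis B0 : forall i, (L0 <= i)%N -> B i = false.
Variable f : signature -> C.
Hypothesis fE : forall L nu, (L0 <= L)%N -> bounded L nu ->
  f nu = Z wt st1 A (bits nu) L (map isF st1) * Z wt st2 (bits nu) B L (map isF st2).
Variables (l c1 c2 rate : C).
Hypothesis lim : forall L, (L0 <= L)%N ->
  `|Z wt (st1 ++ st2) A B L (map isF (st1 ++ st2)) - l| <= c1 * rate ^+ L.
Hypothesis tail : forall L L', (L0 <= L <= L')%N ->
  0 <= Z absw (st1 ++ st2) A B L' (map isF (st1 ++ st2))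
       - Z absw (st1 ++ st2) A B L (map isF (st1 ++ st2)) <= c2 * rate ^+ L.

Lemma sum_sigs (w : I -> nat -> bool -> bool -> bool -> bool -> C) L :
  \sum_(nu <- sigs L) Z w st1 A (bits nu) L (map isF st1) * Z w st2 (bits nu) B L (map isF st2)
  = Z w (st1 ++ st2) A B L (map isF (st1 ++ st2)).
Proof.
rewrite map_cat Z_cat ?size_map // big_map.
by apply: eq_bigr => V _; rewrite bits_sig_of.
Qed.

(** The terms in [sigs L] add up to the partition function of the whole stack, which is close to
    [l]. The remaining ones are dominated by the growth from [L] to some [L'] of the partition
    function with absolute weights. *)
Lemma partial_sum_close L (S : seq signature) : (L0 <= L)%N -> uniq S ->
  {subset sigs L <= S} -> `|\sum_(nu <- S) f nu - l| <= (c1 + c2) * rate ^+ L.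
Proof.
move=> L0L uS LS.
have [L' LL' SL'] : exists2 L', (L <= L')%N & {subset S <= sigs L'}.
  elim: S {uS LS} => [|nu S [L' LL' IH]]; first by exists L.
  have [m mb] := bounded_ex nu; exists (maxn m L'); first by rewrite leq_max LL' orbT.
  move=> nu'; rewrite inE => /orP[/eqP ->|/IH /mem_sigs b]; apply/mem_sigs.
    exact: boundedW (leq_maxl _ _) mb.
  exact: boundedW (leq_maxr _ _) b.
have L0L' : (L0 <= L')%N by apply: leq_trans LL'.
rewrite (sum_subset f (sigs_uniq L) uS LS).
have -> : \sum_(nu <- sigs L) f nu = Z wt (st1 ++ st2) A B L (map isF (st1 ++ st2)).
  rewrite -sum_sigs; apply: eq_big_seq => nu /mem_sigs b; exact: fE.
rewrite addrAC (le_trans (ler_normD _ _)) // mulrDl lerD ?lim //.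
(* [g] dominates the terms and is evaluated in the same [L'] columns for all signatures of [S]. *)
pose g nu := Z absw st1 A (bits nu) L' (map isF st1) * Z absw st2 (bits nu) B L' (map isF st2).
have aw0 k i u a v b : 0 <= absw k i u a v b by apply: normr_ge0.
have afl k i : absw k i false (isF k) false (isF k) = 1 by rewrite /absw wt_fl normr1.
have acons k i u a v b : absw k i u a v b != 0 -> (u + a = v + b :> nat)%N.
  by rewrite normr_eq0; apply: wt_conserve.
have g0 nu : 0 <= g nu by rewrite mulr_ge0 ?Z_ge0.
have fg nu : nu \in sigs L' -> `|f nu| <= g nu.
  by move=> /mem_sigs b; rewrite (fE L0L' b) normrM ler_pM ?norm_Z.
have /andP[_] := tail (L := L) (L' := L') (introT andP (conj L0L LL')); apply: le_trans.
apply: (@le_trans _ _ (\sum_(nu <- S | nu \notin sigs L) g nu)).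
  apply: (le_trans (ler_norm_sum _ _ _)); rewrite big_seq_cond [leRHS]big_seq_cond.
  by apply: ler_sum => nu /andP[nuS _]; apply/fg/SL'.
apply: (@le_trans _ _ (\sum_(nu <- sigs L' | nu \notin sigs L) g nu)).
  rewrite big_mkcond [leRHS]big_mkcond /=.
  rewrite (sum_subset _ uS (sigs_uniq L') SL') lerDl sumr_ge0 // => nu _.
  by case: ifP.
rewrite lerBrDl -(sum_sigs absw L').
have sLL' : {subset sigs L <= sigs L'}.
  by move=> nu /mem_sigs b; apply/mem_sigs; apply: boundedW b.
rewrite [leRHS](sum_subset _ (sigs_uniq L) (sigs_uniq L') sLL') lerD2r.
(* On [sigs L], passing from [L] to [L'] columns can only increase the nonnegative partition
   functions. *)
rewrite -(sum_sigs absw L) big_seq [leRHS]big_seq; apply: ler_sum => nu /mem_sigs b.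
by apply: ler_pM; rewrite ?Z_ge0 ?Z_fl_mono // => i Li; rewrite ?A0 ?B0 ?b //; apply: leq_trans Li.
Qed.

End Summation.

(** * Limits along finite sets of signatures *)

Section ComplexLimit.
Variable R : realType.

(** Comparison with 0 forces [c] and [e] to be real, which reduces the claim to a real geometric
    sequence. *)
Lemma complex_geometric_small (t : R) (c e : R[i]) : 0 < t < 1 -> 0 <= c -> 0 < e ->
  \forall L \near \oo, c * (t%:C)%C ^+ L < e.
Proof.
move=> /andP[t0 t1].
case: c => c c'; case: e => e e'; rewrite lecE ltcE /= => /andP[/eqP -> c0] /andP[/eqP -> e0].
have [n _ hn] : \forall L \near \oo, c * t ^+ L < e.
  have : (fun L => c * t ^+ L) @ \oo --> c * 0.
    by apply: cvgMr; apply: cvg_expr; rewrite ger0_norm // ltW.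
  rewrite mulr0 => /cvgr_lt; exact.
exists n => // L /hn /=.
by rewrite -rmorphXn /= ltcE /= !mulr0 !mul0r subr0 addr0 eqxx.
Qed.

Lemma cvg_partial_sum (f : signature -> R[i]^o) (l : R[i]) (c : R[i]) (t : R) L0 :
  0 < t < 1 -> 0 <= c ->
  (forall L (S : seq signature), (L0 <= L)%N -> uniq S -> {subset sigs L <= S} ->
     `|\sum_(nu <- S) f nu - l| <= c * (t%:C)%C ^+ L) ->
  partial_sum f @ totally --> (l : R[i]^o).
Proof.
move=> t01 c0 close; have FF : Filter (@totally signature) by apply: totally_filter.
apply/cvgrPdist_lt => e e0.
have [n _ hn] := complex_geometric_small t01 c0 e0.
pose L := maxn n L0.
exists [fset nu in sigs L]%fset => // S /fsubsetP LS /=.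
rewrite distrC; apply: le_lt_trans (hn L (leq_maxl _ _)).
rewrite /partial_sum -(big_seq_fsetE _ S xpredT f); apply: close.
- exact: leq_maxr.
- exact: fset_uniq.
- by move=> nu nuL; apply: LS; rewrite inE.
Qed.
End ComplexLimit.

(** * G and F as partition functions of stacked rows *)

Section Identification.
Variables (C : numFieldType) (M N : nat).
Variables (x r : 'I_M -> C) (w theta : 'I_N -> C) (y s : nat -> C).
Let wt := rowwt x r w theta y s.
Let Grows : seq ('I_M + 'I_N) := map inr (enum 'I_N).
Let Frows : seq ('I_M + 'I_N) := map inl (enum 'I_M).

Lemma isF_Grows : map (@isF M N) Grows = nseq N false.
Proof. by rewrite -map_comp map_const size_enum_ord. Qed.

Lemma isF_Frows : map (@isF M N) Frows = nseq M true.
Proof. by rewrite -map_comp map_const size_enum_ord. Qed.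

Lemma G_transfer L lam mu : bounded L lam -> bounded L mu ->
  G lam mu w y theta s = Z wt Grows (bits mu) (bits lam) L (map (@isF M N) Grows).
Proof.
move=> bl bm; rewrite isF_Grows /Grows Z_map /G; case: eqP => [_|np].
  apply: sum_configs.
  - move=> j; exact: (@rowwt_conserve _ _ _ x r w theta y s (inr j)).
  - by [].
  - by move=> i Li; apply/negbT/bm.
  - by move=> i Li; apply/negbT/bl.
(* If the numbers of parts differ, conservation makes the partition function vanish, in agreement
   with the convention for [G]. *)
apply/esym/eqP; apply: contra_notT np => nz.
have := Z_conserve (fun j => @rowwt_conserve _ _ _ x r w theta y s (inr j)) _ nz.
rewrite size_nseq size_enum_ord => /(_ erefl).
by rewrite !sum_bits // count_nseq addn0.
Qed.

Lemma F_transfer L lam mu :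
  (forall p i, y i - x p != 0) -> (forall p i, s i ^- 2 * y i - x p != 0) ->
  bounded L lam -> bounded L mu ->
  F lam mu x y r s = Z wt Frows (bits lam) (bits mu) L (map (@isF M N) Frows).
Proof.
move=> yx Sx bl bm; rewrite isF_Frows /Frows Z_map /F; case: eqP => [_|np].
  apply: sum_configs.
  - move=> j; exact: (@rowwt_conserve _ _ _ x r w theta y s (inl j)).
  - by move=> j i; rewrite /What /W divff // mulf_neq0 ?invr_eq0.
  - by move=> i Li; apply/negbT/bl.
  - by move=> i Li; apply/negbT/bm.
apply/esym/eqP; apply: contra_notT np => nz.
have := Z_conserve (fun j => @rowwt_conserve _ _ _ x r w theta y s (inl j)) _ nz.
rewrite size_nseq size_enum_ord => /(_ erefl).
by rewrite !sum_bits // count_nseq mul1n.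
Qed.

End Identification.

(** * From limits of stacks to the summation identity *)

Lemma norm_lt_real (R : realType) (z : R[i]) (a : R) : `|z| < (a%:C)%C -> 0 < a.
Proof.
by move=> h; have := le_lt_trans (normr_ge0 z) h; rewrite ltcE /= => /andP[].
Qed.

Theorem proposition3p7 (R : realType) (lam mu : signature) (M N : nat)
    (hM : (1 <= M)%N) (hN : (1 <= N)%N)
    (x r : 'I_M -> R[i]) (w theta : 'I_N -> R[i]) (y s : nat -> R[i])
    (hden : nonvanishing_denominators x r w theta y s)
    (delta : R) (hdelta : 0 < delta)
    (hratio : forall (i : 'I_M) (j : 'I_N) (k : nat),
       `| (y k - s k ^+ 2 * x i) / (y k - x i)
          * ((y k - w j) / (y k - s k ^+ 2 * w j)) | < ((1 - delta)%:C)%C) :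
  let lhs_term (nu : signature) : R[i]^o :=
    G nu lam w y theta s * F nu mu x y r s in
  let rhs_term (kappa : signature) : R[i]^o :=
    G mu kappa w y theta s * F lam kappa x y r s in
  [/\ cvg (partial_sum lhs_term @ totally),
      cvg (partial_sum rhs_term @ totally)
    & summability.sum lhs_term
      = (\prod_(i < M) \prod_(j < N)
           ((x i - theta j ^- 2 * w j) / (x i - w j)))
        * summability.sum rhs_term].
Proof.
move=> lhs rhs.
case: hden => -[_ _ sN0] xw Sx [eps eps0 [Gden Fden]].
have FF : ProperFilter (@totally signature) by apply: totally_filter.
have sumE (f : signature -> R[i]^o) (l : R[i]) :
    partial_sum f @ totally --> (l : R[i]^o) -> summability.sum f = l.
  by move=> fl; apply: cvg_lim fl; apply: norm_hausdorff.
suff [l [Ll Lr]] : exists l : R[i],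
    partial_sum lhs @ totally --> ((\prod_(i < M) \prod_(j < N)
           ((x i - theta j ^- 2 * w j) / (x i - w j))) * l : R[i]^o)
    /\ partial_sum rhs @ totally --> (l : R[i]^o).
  by split; [apply: cvgP Ll | apply: cvgP Lr | rewrite (sumE _ _ Ll) (sumE _ _ Lr)].
(* Unless the numbers of parts of [lam] and [mu] differ by [M], every term on both sides is 0. *)
have [np|np] := eqVneq (nparts lam) (nparts mu + M)%N; last first.
  exists 0; rewrite mulr0.
  have zero (f : signature -> R[i]^o) : (forall nu, f nu = 0) ->
      partial_sum f @ totally --> (0 : R[i]^o).
    move=> f0; rewrite (_ : partial_sum f = cst 0); first exact: cvg_cst.
    by apply/funext => S; rewrite /partial_sum big1.
  split; apply: zero => nu; rewrite /lhs /rhs /G /F.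
    case: eqP => [e|_]; last by rewrite mul0r.
    by case: eqP => [e'|_]; rewrite ?mulr0 //; move: np; rewrite -e e' eqxx.
  case: eqP => [e|_]; last by rewrite mul0r.
  by case: eqP => [e'|_]; rewrite ?mulr0 //; move: np; rewrite e e' eqxx.
(* The ratio bound, taken at one index triple, exceeds a norm and is therefore positive. *)
have d1 : 0 < 1 - delta := norm_lt_real (hratio (Ordinal hM) (Ordinal hN) 0%N).
pose rho : R[i] := ((1 - delta)%:C)%C.
have rho01 : 0 < rho < 1 by rewrite !ltcE /= !eqxx d1 /= ltrBlDr ltrDl.
have epsC : 0 < (eps%:C)%C :> R[i] by rewrite ltcE /= eqxx.
have [Ll bl] := bounded_ex lam; have [Lm bm] := bounded_ex mu.
pose L0 := maxn Ll Lm.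
have bl0 : bounded L0 lam := boundedW (leq_maxl _ _) bl.
have bm0 : bounded L0 mu := boundedW (leq_maxr _ _) bm.
have AB : (\sum_(i < L0) bits lam i = \sum_(i < L0) bits mu i + M :> nat)%N.
  by rewrite !sum_bits.
have ratio i j k : `|(y k - s k ^+ 2 * x i) / (y k - x i)
          * ((y k - w j) / (y k - s k ^+ 2 * w j))| <= rho by apply/ltW/hratio.
have yx p i : y i - x p != 0 by rewrite -normr_gt0 (lt_le_trans epsC) ?Fden.
pose Grows : seq ('I_M + 'I_N) := map inr (enum 'I_N).
pose Frows : seq ('I_M + 'I_N) := map inl (enum 'I_M).
have cF : count (@isF M N) (Frows ++ Grows) = M.
  rewrite count_cat -!(count_map (@isF M N) id) isF_Frows isF_Grows !count_nseq.
  by rewrite mul1n addn0.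
have cF' : count (@isF M N) (Grows ++ Frows) = M.
  by rewrite count_cat addnC -count_cat.
have tail := model_decay r theta hM hN epsC rho01 sN0 Sx Gden Fden ratio bl0 bm0 AB.
have [[cF2 cF20 tailF] _] := tail _ cF; have [[cG2 cG20 tailG] _] := tail _ cF'.
pose P := \prod_(i < M) \prod_(j < N) ((x i - theta j ^- 2 * w j) / (x i - w j)).
pose cv st z := conv x r w theta y s rho st (bits lam) (bits mu) L0 z.
(* With F below G the signature between the two blocks is [kappa], so this stack yields the
   right-hand sum; the opposite order has [nu] in between and yields the left-hand sum. *)
have [l convF] : exists l, cv (Frows ++ Grows) l.
  by eexists; exact: (conv_FG r w theta rho epsC Sx Fden bl0 bm0).
have convG : cv (Grows ++ Frows) (P * l).
  have := conv_sort hM hN epsC rho01 sN0 xw Sx Gden Fden ratio bl0 bm0 AB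
    (pre := [::]) (post := [::]) (js := enum 'I_M) (ls := enum 'I_N) (z := l).
  rewrite /= !cats0 => /(_ r theta cF convF).
  rewrite big_enum /= mulrC; under eq_bigr do rewrite big_enum /=.
  by [].
have rateE : rate rho = (((1 + (1 - delta)) / 2)%:C)%C.
  by rewrite /rate /rho rmorphM !rmorphD fmorphV !rmorph1 rmorph_nat.
have t01 : 0 < (1 + (1 - delta)) / 2 < 1 by apply/andP; split; lra.
have [cF1 cF10 limF] := convF; have [cG1 cG10 limG] := convG.
have wtc := @rowwt_conserve _ _ _ x r w theta y s.
have wtf := rowwt_fl r w theta epsC Sx Fden.
exists l; split.
  apply: (cvg_partial_sum t01 (addr_ge0 cG10 cG20) (L0 := L0)) => L S L0L uS LS.
  rewrite -rateE; apply: (partial_sum_close wtc wtf bl0 bm0 _ limG tailG) => //.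
  move=> L' nu L0L' b; rewrite /lhs.
  have bl' := boundedW L0L' bl0; have bm' := boundedW L0L' bm0.
  by rewrite (G_transfer x r w theta y s b bl') (F_transfer r w theta yx Sx b bm').
apply: (cvg_partial_sum t01 (addr_ge0 cF10 cF20) (L0 := L0)) => L S L0L uS LS.
rewrite -rateE; apply: (partial_sum_close wtc wtf bl0 bm0 _ limF tailF) => //.
(* The factors are exchanged because F is the lower block of this stack. *)
move=> L' nu L0L' b; rewrite /rhs mulrC.
have bl' := boundedW L0L' bl0; have bm' := boundedW L0L' bm0.
by rewrite (G_transfer x r w theta y s bm' b) (F_transfer r w theta yx Sx bl' b).
Qed.
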